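(* Let $\mathcal C$ be a modular fusion category (over $\mathbb C$) such that $K(\mathcal C)$ is Burnside. Then in $K(\mathcal C)\otimes_{\mathbb Z}\mathbb C$: $$\Big(\prod_{i=1}^m\frac{x_i}{d_i}\Big)^2=\frac{1}{\mathrm{FPdim}(\mathcal C_{ad})}\Big(\sum_{x_i\in\mathrm{Irr}(\mathcal C_{ad})}d_i\,x_i\Big).$$
   Context: $X_1,\dots,X_m$ are representatives of the isomorphism classes of simple objects of $\mathcal C$ ($X_1$ the unit), $x_i=[X_i]\in K(\mathcal C)$ (the Grothendieck ring), $d_i=\mathrm{FPdim}(X_i)$ the Frobenius–Perron dimension. $\mathcal C_{ad}$ is the adjoint fusion subcategory, generated by all $X_i\otimes X_i^*$; $x_i\in\mathrm{Irr}(\mathcal C_{ad})$ means $X_i\in\mathcal C_{ad}$; $\mathrm{FPdim}(\mathcal C_{ad})=\sum_{X_i\in\mathcal C_{ad}}d_i^2$. $K(\mathcal C)$ is Burnside if for every $i$: there is a unital ring morphism $\mu:K(\mathcal C)\to\mathbb C$ with $\mu(x_i)=0$ if and only if $x_i$ is not grouplike, where $x_i$ is grouplike if $x_i\,[X_i^*]=1$ (equivalently, $d_i=1$, i.e. $X_i$ is invertible). *)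

(* Defs.v *)
From mathcomp Require Import all_boot all_order all_algebra.
From mathcomp Require Import complex.
From mathcomp Require Import boolp classical_sets reals.

Set Implicit Arguments.
Unset Strict Implicit.
Unset Printing Implicit Defensive.

Import Order.TTheory GRing.Theory Num.Theory.

Local Open Scope ring_scope.

Reserved Notation "g \comp f" (at level 40, left associativity).
Reserved Notation "A \ox B" (at level 39, left associativity).
Reserved Notation "f \otm g" (at level 39, left associativity).

(** * K-linear categories with finite-dimensional Hom spaces *)

Record linCat (K : fieldType) := LinCat {
  obj :> Type;
  hom : obj -> obj -> vectType K;
  idm : forall A, hom A A;
  comp : forall A B C, hom B C -> hom A B -> hom A C;
  comp1m : forall A B (f : hom A B), comp (idm B) f = f;
  compm1 : forall A B (f : hom A B), comp f (idm A) = f;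
  compmA : forall A B C D (h : hom C D) (g : hom B C) (f : hom A B),
    comp h (comp g f) = comp (comp h g) f;
  compm_linearr : forall A B C (g : hom B C), linear (@comp A B C g);
  compm_linearl : forall A B C (f : hom A B), linear (fun g => @comp A B C g f) }.

Arguments hom {K C} A B : rename.
Arguments idm {K C} A : rename.
Arguments comp {K C A B} {C0} g f : rename.

Notation "g \comp f" := (comp g f) : ring_scope.

Section LinearCategory.
Variables (K : fieldType) (C : linCat K).
Implicit Types A B Z S : C.

Definition inverses A B (f : hom A B) (g : hom B A) : Prop :=
  g \comp f = idm A /\ f \comp g = idm B.

Definition is_iso A B (f : hom A B) : Prop := exists g, inverses f g.

Definition isomorphic A B : Prop := exists f : hom A B, is_iso f.

Definition is_mono A B (f : hom A B) : Prop :=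
  forall Z (g h : hom Z A), f \comp g = f \comp h -> g = h.

Definition is_epi A B (f : hom A B) : Prop :=
  forall Z (g h : hom B Z), g \comp f = h \comp f -> g = h.

Definition is_kernel A B Z (f : hom A B) (k : hom Z A) : Prop :=
  f \comp k = 0 /\
  forall Y (g : hom Y A), f \comp g = 0 -> exists! h : hom Y Z, k \comp h = g.

Definition is_cokernel A B Z (f : hom A B) (q : hom B Z) : Prop :=
  q \comp f = 0 /\
  forall Y (g : hom B Y), g \comp f = 0 -> exists! h : hom Z Y, h \comp q = g.

(* [S] is a biproduct of the finite family [F]; a zero object for [n = 0]. *)
Definition direct_sum n (F : 'I_n -> C) S : Prop :=
  exists (inj : forall i, hom (F i) S) (proj : forall i, hom S (F i)),
    [/\ forall i, proj i \comp inj i = idm (F i),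
        forall i j, i != j -> proj i \comp inj j = 0
      & \sum_(i < n) inj i \comp proj i = idm S].

Definition abelian_cat : Prop :=
  [/\ forall n (F : 'I_n -> C), exists S, direct_sum F S,
      forall A B (f : hom A B), exists Z (k : hom Z A), is_kernel f k,
      forall A B (f : hom A B), exists Z (q : hom B Z), is_cokernel f q,
      forall A B (f : hom A B), is_mono f ->
        exists Z (g : hom B Z), is_kernel g f
    & forall A B (f : hom A B), is_epi f ->
        exists Z (g : hom Z A), is_cokernel g f].

Definition simple A : Prop :=
  idm A <> 0 /\ forall B (f : hom B A), is_mono f -> f = 0 \/ is_iso f.

Definition semisimple_cat : Prop :=
  forall A, exists n (F : 'I_n -> C), (forall i, simple (F i)) /\ direct_sum F A.

Definition simple_reps m (X : 'I_m -> C) : Prop :=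
  [/\ forall i, simple (X i),
      forall i j, isomorphic (X i) (X j) -> i = j
    & forall A, simple A -> exists i, isomorphic A (X i)].

End LinearCategory.

(** * Monoidal, rigid and fusion categories *)

Record monCat (K : fieldType) := MonCat {
  mon_cat :> linCat K;
  tens : mon_cat -> mon_cat -> mon_cat;
  tensm : forall A B A' B' : mon_cat,
    hom A B -> hom A' B' -> hom (tens A A') (tens B B');
  unitob : mon_cat;
  assoc : forall A B C, hom (tens (tens A B) C) (tens A (tens B C));
  assocV : forall A B C, hom (tens A (tens B C)) (tens (tens A B) C);
  lunit : forall A, hom (tens unitob A) A;
  lunitV : forall A, hom A (tens unitob A);
  runit : forall A, hom (tens A unitob) A;
  runitV : forall A, hom A (tens A unitob);
  tensm1 : forall A B, tensm (idm A) (idm B) = idm (tens A B);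
  tensm_comp : forall A B C A' B' C' (g : hom B C) (f : hom A B)
    (g' : hom B' C') (f' : hom A' B'),
    tensm (g \comp f) (g' \comp f') = tensm g g' \comp tensm f f';
  tensm_linearr : forall A B A' B' (f : hom A B), linear (@tensm A B A' B' f);
  tensm_linearl : forall A B A' B' (g : hom A' B'),
    linear (fun f : hom A B => tensm f g);
  assocK : forall A B C, inverses (assoc A B C) (assocV A B C);
  lunitK : forall A, inverses (lunit A) (lunitV A);
  runitK : forall A, inverses (runit A) (runitV A);
  assoc_natural : forall A B C A' B' C'
    (f : hom A A') (g : hom B B') (h : hom C C'),
    assoc A' B' C' \comp tensm (tensm f g) h
      = tensm f (tensm g h) \comp assoc A B C;
  lunit_natural : forall A B (f : hom A B),
    lunit B \comp tensm (idm unitob) f = f \comp lunit A;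
  runit_natural : forall A B (f : hom A B),
    runit B \comp tensm f (idm unitob) = f \comp runit A;
  pentagon : forall A B C D,
    assoc A B (tens C D) \comp assoc (tens A B) C D
      = tensm (idm A) (assoc B C D) \comp assoc A (tens B C) D
          \comp tensm (assoc A B C) (idm D);
  triangle : forall A B,
    tensm (idm A) (lunit B) \comp assoc A unitob B = tensm (runit A) (idm B) }.

Arguments unitob {K} C : rename.
Arguments tens {K C} A B : rename.
Arguments tensm {K C A B A' B'} f g : rename.
Arguments assoc {K C} A B C0 : rename.
Arguments assocV {K C} A B C0 : rename.
Arguments lunit {K C} A : rename.
Arguments lunitV {K C} A : rename.
Arguments runit {K C} A : rename.
Arguments runitV {K C} A : rename.

Notation "A \ox B" := (tens A B) : ring_scope.
Notation "f \otm g" := (tensm f g) : ring_scope.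

(* [A'] is a left dual of [A], i.e. [A] is a right dual of [A']. *)
Definition is_duality K (C : monCat K) (A A' : C)
    (ev : hom (A' \ox A) (unitob C)) (coev : hom (unitob C) (A \ox A')) : Prop :=
  runit A \comp (idm A \otm ev) \comp assoc A A' A \comp (coev \otm idm A)
      \comp lunitV A = idm A /\
  lunit A' \comp (ev \otm idm A') \comp assocV A' A A' \comp (idm A' \otm coev)
      \comp runitV A' = idm A'.

Record rigidCat (K : fieldType) := RigidCat {
  rigid_mon :> monCat K;
  dual : rigid_mon -> rigid_mon;
  ev : forall A, hom (dual A \ox A) (unitob rigid_mon);
  coev : forall A, hom (unitob rigid_mon) (A \ox dual A);
  dualP : forall A, is_duality (ev A) (coev A);
  right_dual_ex : forall A, exists A' (ev' : hom (A \ox A') (unitob rigid_mon))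
    (coev' : hom (unitob rigid_mon) (A' \ox A)), is_duality ev' coev' }.

Arguments dual {K C} A : rename.
Arguments ev {K C} A : rename.
Arguments coev {K C} A : rename.

Definition dualm K (C : rigidCat K) (A B : C) (f : hom A B) :
    hom (dual B) (dual A) :=
  lunit (dual A) \comp (ev B \otm idm (dual A)) \comp assocV (dual B) B (dual A)
    \comp (idm (dual B) \otm (f \otm idm (dual A)))
    \comp (idm (dual B) \otm coev A) \comp runitV (dual B).

Record fusionCat (K : fieldType) := FusionCat {
  fusion_rigid :> rigidCat K;
  fusion_abelian : abelian_cat fusion_rigid;
  fusion_semisimple : semisimple_cat fusion_rigid;
  fusion_finite : exists m (X : 'I_m -> fusion_rigid), simple_reps X;
  fusion_unit : simple (unitob fusion_rigid) }.

(** * Braided, ribbon and modular fusion categories *)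

Record braidedFusionCat (K : fieldType) := BraidedFusionCat {
  braided_fusion :> fusionCat K;
  braid : forall A B : braided_fusion, hom (A \ox B) (B \ox A);
  braid_iso : forall A B, is_iso (braid A B);
  braid_natural : forall A B A' B' (f : hom A A') (g : hom B B'),
    braid A' B' \comp (f \otm g) = (g \otm f) \comp braid A B;
  hexagon1 : forall A B C,
    assoc B C A \comp braid A (B \ox C) \comp assoc A B C
      = (idm B \otm braid A C) \comp assoc B A C \comp (braid A B \otm idm C);
  hexagon2 : forall A B C,
    assocV C A B \comp braid (A \ox B) C \comp assocV A B C
      = (braid A C \otm idm B) \comp assocV A C B \comp (idm A \otm braid B C) }.

Arguments braid {K C} A B : rename.

Record ribbonFusionCat (K : fieldType) := RibbonFusionCat {
  ribbon_braided :> braidedFusionCat K;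
  twist : forall A : ribbon_braided, hom A A;
  twist_iso : forall A, is_iso (twist A);
  twist_natural : forall A B (f : hom A B), twist B \comp f = f \comp twist A;
  twist_tens : forall A B,
    twist (A \ox B) = (twist A \otm twist B) \comp braid B A \comp braid A B;
  twist_dual : forall A, twist (dual A) = dualm (twist A) }.

Arguments twist {K C} A : rename.

(* The scalar [a] with [f = a *: idm 1], when 1 is simple and K is closed. *)
Definition end_unit_scalar K (C : monCat K) (f : hom (unitob C) (unitob C)) : K :=
  coord [tuple idm (unitob C)] ord0 f.

(* [ev \comp braid \comp (twist \otm id)] is the pairing [A \ox dual A -> 1]
   coming from the pivotal structure [A -> dual (dual A)] given by the Drinfeld
   isomorphism composed with the twist; so this is the quantum trace. *)
Definition qtrace K (C : ribbonFusionCat K) (A : C) (f : hom A A) : K :=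
  end_unit_scalar
    (ev A \comp braid A (dual A) \comp ((twist A \comp f) \otm idm (dual A))
       \comp coev A).

Definition S_matrix K (C : ribbonFusionCat K) m (X : 'I_m -> C) : 'M[K]_m :=
  \matrix_(i, j) qtrace (braid (X j) (X i) \comp braid (X i) (X j)).

Record modularFusionCat (K : fieldType) := ModularFusionCat {
  modular_ribbon :> ribbonFusionCat K;
  S_nondegenerate : forall m (X : 'I_m -> modular_ribbon),
    simple_reps X -> S_matrix X \in unitmx }.

(** * The Grothendieck ring *)

(* With [X] representatives of the simple objects, an element of
   [K(C) (x)_Z A] is the row vector of its coordinates in the basis [X_i]. *)
Section GrothendieckRing.
Variables (K : fieldType) (C : fusionCat K) (m : nat) (X : 'I_m -> C).

Definition multiplicity (k : 'I_m) (Y : C) : nat := \dim {: hom (X k) Y}.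

Section Coefficients.
Variable A : comPzRingType.

Definition gr_class (Y : C) : 'rV[A]_m := \row_k (multiplicity k Y)%:R.

Definition gr_one : 'rV[A]_m := gr_class (unitob C).

Definition gr_mul (u v : 'rV[A]_m) : 'rV[A]_m :=
  \sum_i \sum_j (u 0 i * v 0 j) *: gr_class (X i \ox X j).

(* Bracketed to the right: the ring laws of [gr_mul] are not proved here. *)
Definition gr_prod n (F : 'I_n -> 'rV[A]_m) : 'rV[A]_m :=
  \big[gr_mul/gr_one]_(i < n) F i.

End Coefficients.

Definition grouplike (i : 'I_m) : Prop :=
  gr_mul (gr_class int (X i)) (gr_class int (dual (X i))) = gr_one int.

Definition gr_morphism (L : pzRingType) (mu : 'rV[int]_m -> L) : Prop :=
  [/\ forall u v, mu (u + v) = mu u + mu v,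
      forall u v, mu (gr_mul u v) = mu u * mu v
    & mu (gr_one int) = 1].

Definition burnside (L : pzRingType) : Prop :=
  forall i : 'I_m,
    (exists mu : 'rV[int]_m -> L, gr_morphism mu /\ mu (gr_class int (X i)) = 0)
      <-> ~ grouplike i.

Section FrobeniusPerron.
Variable R : realType.

Definition left_mul_mx (Y : C) : 'M[R]_m :=
  \matrix_(i, k) (multiplicity k (Y \ox X i))%:R.

(* The largest nonnegative eigenvalue. *)
Definition FPdim (Y : C) : R :=
  sup [set a : R | 0 <= a /\ eigenvalue (left_mul_mx Y) a].

End FrobeniusPerron.

End GrothendieckRing.

(** * The adjoint subcategory *)

(* Full subcategories, as predicates on objects. Closure under direct sums and
   under direct summands (hence, with [n = 1], under isomorphism) is the
   equivalence in the last clause. *)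
Definition fusion_subcat K (C : fusionCat K) (D : C -> Prop) : Prop :=
  [/\ D (unitob C),
      forall A B, D A -> D B -> D (A \ox B),
      forall A, D A -> D (dual A)
    & forall n (F : 'I_n -> C) S, direct_sum F S -> (D S <-> forall i, D (F i))].

Definition adjoint_subcat K (C : fusionCat K) (Y : C) : Prop :=
  forall D : C -> Prop, fusion_subcat D ->
    (forall A, simple A -> D (A \ox dual A)) -> D Y.

(* Main.v *)
(** By the balancing of the ribbon structure, the closed strand of [Y] around a strand
    of [X_j] is a scalar [mu_j(Y)], multiplicative in [Y], and [S_ji = dim(X_j) mu_j(x_i)];
    as [S] is symmetric and invertible, the [mu_j] are all the characters of [K(C)], and
    [mu_j(x_i) = 0] if and only if [mu_i(x_j) = 0]. By the Burnside property, [mu_j] has a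
    zero if and only if [x_j] is not grouplike. A Perron-Frobenius argument provides a
    [j0] with [mu_j0 = FPdim], and [x_j0] is then grouplike. It suffices to compare the
    values of the characters on both sides of the formula. If [x_j] is not grouplike, the
    left-hand side vanishes; so does the right-hand side, for otherwise [mu_j] equals
    [FPdim] on the adjoint part, hence on each [x_i x_i^*], and has no zero. If [x_j] is
    grouplike, the symmetry of [S] gives [|mu_j(x_i)| = d_i]; then [mu_j / d] is a grading
    of [K(C)], trivial on the adjoint part, and its values at [x_i] and [x_i^*] are inverse
    to each other, so that both sides are [1]. *)

From HB Require Import structures.
Require Import Defs.
From mathcomp Require Import all_boot all_order all_algebra.
From mathcomp Require Import complex.
From mathcomp Require Import boolp classical_sets reals.

Set Implicit Arguments.
Unset Strict Implicit.
Unset Printing Implicit Defensive.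

Import Order.TTheory GRing.Theory Num.Theory.
(* Restores [hom] and [comp], which later imports shadow. *)
Import Defs.

Local Open Scope ring_scope.

(** Two obstacles shape the proof. First, the tensor product is not strict, while the
    multiplicativity of the scalars [mu_j] is a statement about strands. An object [A] is therefore
    used through the functor that tensors a variable object [T] with [A] on the left: words are
    bracketed to the right, cups, caps and crossings act on the leftmost strands, and the coherence
    axioms are spent once, in the lemmas on these building blocks. The trace over a product also
    refers to the chosen dual of that product; loops are defined for an arbitrary dual, and
    cyclicity shows that they do not depend on it, so nested duals may be used instead. Second,
    quantum dimensions are not known to be positive, only nonzero. This is enough to make the matrix
    of multiplication by the sum of all simple objects strictly positive. Its eigenvectors are the
    orthogonal vectors [mu_j], and a positive one is found among them by maximizing the eigenvalue.
    For every grouplike [x_j], the element [x_j0] included, the symmetry of [S] gives the same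
    moduli: the modulus of [mu_j(x_i)] is that of [dim(X_i)] divided by that of [dim(1)]. *)

Section LinearCategoryTheory.
Variables (K : fieldType) (C : linCat K).
Implicit Types A B D S : C.

(* The three lemmas below turn an equation between composites into one that
   rewrites the head of a right-nested composite; the two digits count the factors
   on each side. *)
Lemma compR21 A B D S (f : hom B D) (g : hom A B) (h : hom A D) :
  f \comp g = h -> forall k : hom S A, f \comp (g \comp k) = h \comp k.
Proof. by move=> e k; rewrite compmA e. Qed.

Lemma compR22 A B B' D S (f : hom B D) (g : hom A B) (f' : hom B' D) (g' : hom A B') :
  f \comp g = f' \comp g' ->
  forall k : hom S A, f \comp (g \comp k) = f' \comp (g' \comp k).
Proof. by move=> e k; rewrite compmA e compmA. Qed.

Lemma compR31 A B B' D S (f : hom B' D) (g : hom B B') (h : hom A B) (l : hom A D) :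
  f \comp (g \comp h) = l ->
  forall k : hom S A, f \comp (g \comp (h \comp k)) = l \comp k.
Proof. by move=> e k; rewrite -e -!compmA. Qed.

Lemma compDr A B D (f : hom B D) (g h : hom A B) :
  f \comp (g + h) = f \comp g + f \comp h.
Proof. by have := compm_linearr f 1 g h; rewrite !scale1r. Qed.

Lemma compDl A B D (f : hom A B) (g h : hom B D) :
  (g + h) \comp f = g \comp f + h \comp f.
Proof. by have := compm_linearl f 1 g h; rewrite !scale1r. Qed.

Lemma comp0r A B D (f : hom B D) : f \comp (0 : hom A B) = 0.
Proof. by apply: (addrI (f \comp 0)); rewrite -compDr !addr0. Qed.

Lemma comp0l A B D (f : hom A B) : (0 : hom B D) \comp f = 0.
Proof. by apply: (addrI (0 \comp f)); rewrite -compDl !addr0. Qed.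

Lemma compZr A B D (f : hom B D) a (g : hom A B) :
  f \comp (a *: g) = a *: (f \comp g).
Proof. by have := compm_linearr f a g 0; rewrite comp0r !addr0. Qed.

Lemma compZl A B D (f : hom A B) a (g : hom B D) :
  (a *: g) \comp f = a *: (g \comp f).
Proof. by have := compm_linearl f a g 0; rewrite comp0l !addr0. Qed.

Lemma compBr A B D (f : hom B D) (g h : hom A B) :
  f \comp (g - h) = f \comp g - f \comp h.
Proof. by rewrite compDr -scaleN1r compZr scaleN1r. Qed.

Lemma compBl A B D (f : hom A B) (g h : hom B D) :
  (g - h) \comp f = g \comp f - h \comp f.
Proof. by rewrite compDl -scaleN1r compZl scaleN1r. Qed.

Lemma comp_sumr A B D n (f : hom B D) (g : 'I_n -> hom A B) :
  f \comp (\sum_i g i) = \sum_i f \comp g i.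
Proof.
elim: n g => [|n IHn] g; first by rewrite !big_ord0 comp0r.
by rewrite !big_ord_recl compDr IHn.
Qed.

Lemma comp_suml A B D n (f : hom A B) (g : 'I_n -> hom B D) :
  (\sum_i g i) \comp f = \sum_i g i \comp f.
Proof.
elim: n g => [|n IHn] g; first by rewrite !big_ord0 comp0l.
by rewrite !big_ord_recl compDl IHn.
Qed.

Lemma inverses_cancell A B D (f : hom A B) (g : hom B A) (h k : hom D A) :
  inverses f g -> f \comp h = f \comp k -> h = k.
Proof.
by case=> gf _ /(congr1 (comp g)); rewrite !compmA gf !comp1m.
Qed.

Lemma inverses_cancelr A B D (f : hom A B) (g : hom B A) (h k : hom B D) :
  inverses f g -> h \comp f = k \comp f -> h = k.
Proof.
case=> _ fg /(congr1 (fun u => u \comp g)).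
by rewrite -!compmA fg !compm1.
Qed.

Lemma isomorphic_sym A B : isomorphic A B -> isomorphic B A.
Proof. by case=> f [g [gf fg]]; exists g, f. Qed.

Lemma isomorphic_direct_sum A B : isomorphic A B -> direct_sum (fun _ : 'I_1 => A) B.
Proof.
case=> f [g [gf fg]]; exists (fun=> f), (fun=> g); split=> [i|i j|].
- exact: gf.
- by rewrite !ord1 eqxx.
- by rewrite big_ord1.
Qed.

Definition scalar_end A := forall f : hom A A, exists a, f = a *: idm A.

End LinearCategoryTheory.

(** * Monoidal categories without visible associators *)

Section MonoidalTheory.
Variables (K : fieldType) (C : monCat K).
Implicit Types A B E P Q S T U : C.

(** An object [A] acts as the functor of tensoring with [A] on the left: [whisk A] is this functor
    on morphisms, and [act f] is the natural transformation induced by [f]. *)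
Definition whisk A S T (f : hom S T) : hom (A \ox S) (A \ox T) := idm A \otm f.
Definition act A B (f : hom A B) T : hom (A \ox T) (B \ox T) := f \otm idm T.

Lemma whisk1 A S : whisk A (idm S) = idm _.
Proof. exact: tensm1. Qed.

Lemma whiskM A S T U (g : hom T U) (f : hom S T) :
  whisk A (g \comp f) = whisk A g \comp whisk A f.
Proof. by rewrite /whisk -tensm_comp comp1m. Qed.

Lemma act1 A S : act (idm A) S = idm _.
Proof. exact: tensm1. Qed.

Lemma actM A B E (g : hom B E) (f : hom A B) T :
  act (g \comp f) T = act g T \comp act f T.
Proof. by rewrite /act -tensm_comp comp1m. Qed.

Lemma act_whisk A B S T (f : hom A B) (g : hom S T) :
  act f T \comp whisk A g = whisk B g \comp act f S.
Proof. by rewrite /act /whisk -!tensm_comp !comp1m !compm1. Qed.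

Lemma tensm_act A B S T (f : hom A B) (g : hom S T) :
  f \otm g = act f T \comp whisk A g.
Proof. by rewrite /act /whisk -!tensm_comp !comp1m !compm1. Qed.

Lemma tensmZl A B S T a (f : hom A B) (g : hom S T) :
  (a *: f) \otm g = a *: (f \otm g).
Proof.
have h0 : (0 : hom A B) \otm g = 0.
  have := tensm_linearl g 1 (0 : hom A B) 0; rewrite !scale1r addr0.
  by move=> h; apply: (addrI (0 \otm g)); rewrite addr0 -h.
by have := tensm_linearl g a f 0; rewrite h0 !addr0.
Qed.

Lemma tensmDl A B S T (f f' : hom A B) (g : hom S T) :
  (f + f') \otm g = f \otm g + f' \otm g.
Proof. by have := tensm_linearl g 1 f f'; rewrite !scale1r. Qed.

Lemma tensmDr A B S T (f : hom A B) (g g' : hom S T) :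
  f \otm (g + g') = f \otm g + f \otm g'.
Proof. by have := tensm_linearr f 1 g g'; rewrite !scale1r. Qed.

Lemma tensm0l A B S T (g : hom S T) : (0 : hom A B) \otm g = 0.
Proof. by apply: (addrI (0 \otm g)); rewrite -tensmDl !addr0. Qed.

Lemma tensm0r A B S T (f : hom A B) : f \otm (0 : hom S T) = 0.
Proof. by apply: (addrI (f \otm 0)); rewrite -tensmDr !addr0. Qed.

Lemma tensmZr A B S T a (f : hom A B) (g : hom S T) :
  f \otm (a *: g) = a *: (f \otm g).
Proof. by have := tensm_linearr f a g 0; rewrite tensm0r !addr0. Qed.

Lemma tensm_suml A B S T n (f : 'I_n -> hom A B) (g : hom S T) :
  (\sum_i f i) \otm g = \sum_i f i \otm g.
Proof.
elim: n f => [|n IHn] f; first by rewrite !big_ord0 tensm0l.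
by rewrite !big_ord_recl tensmDl IHn.
Qed.

Lemma tensm_sumr A B S T n (f : hom A B) (g : 'I_n -> hom S T) :
  f \otm (\sum_i g i) = \sum_i f \otm g i.
Proof.
elim: n g => [|n IHn] g; first by rewrite !big_ord0 tensm0r.
by rewrite !big_ord_recl tensmDr IHn.
Qed.

Lemma assocVassoc A B T : assocV A B T \comp assoc A B T = idm _.
Proof. by case: (assocK A B T). Qed.

Lemma assocassocV A B T : assoc A B T \comp assocV A B T = idm _.
Proof. by case: (assocK A B T). Qed.

Lemma lunitlunitV A : lunit A \comp lunitV A = idm _.
Proof. by case: (lunitK A). Qed.

Lemma runitrunitV A : runit A \comp runitV A = idm _.
Proof. by case: (runitK A). Qed.

Lemma assoc_act2 A B S T (f : hom A B) :
  assoc B S T \comp act (act f S) T = act f (S \ox T) \comp assoc A S T.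
Proof. by rewrite /act assoc_natural tensm1. Qed.

Lemma assoc_act_whisk A S T U (f : hom S T) :
  assoc A T U \comp act (whisk A f) U = whisk A (act f U) \comp assoc A S U.
Proof. by rewrite /act /whisk assoc_natural. Qed.

Lemma assoc_whisk A B S T (f : hom S T) :
  assoc A B T \comp whisk (A \ox B) f = whisk A (whisk B f) \comp assoc A B S.
Proof. by rewrite /whisk -tensm1 assoc_natural. Qed.

Lemma inverses_swap A B A' B' (i : hom A B) (i' : hom B A) (j : hom A' B')
    (j' : hom B' A') (f : hom A A') (g : hom B B') :
  inverses i i' -> inverses j j' -> j \comp f = g \comp i ->
  f \comp i' = j' \comp g.
Proof.
move=> [i'i ii'] [j'j jj'] e.
rewrite -[f]comp1m -j'j -!compmA; congr (_ \comp _).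
by rewrite compmA e -compmA ii' compm1.
Qed.

Lemma assocV_act2 A B S T (f : hom A B) :
  act (act f S) T \comp assocV A S T = assocV B S T \comp act f (S \ox T).
Proof.
exact: inverses_swap (assocK _ _ _) (assocK _ _ _) (assoc_act2 _ _ _).
Qed.

Lemma assocV_act_whisk A S T U (f : hom S T) :
  act (whisk A f) U \comp assocV A S U = assocV A T U \comp whisk A (act f U).
Proof.
exact: inverses_swap (assocK _ _ _) (assocK _ _ _) (assoc_act_whisk _ _ _).
Qed.

Lemma assocV_whisk A B S T (f : hom S T) :
  whisk (A \ox B) f \comp assocV A B S = assocV A B T \comp whisk A (whisk B f).
Proof.
exact: inverses_swap (assocK _ _ _) (assocK _ _ _) (assoc_whisk _ _ _).
Qed.

Lemma lunit_whisk A B (f : hom A B) :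
  lunit B \comp whisk (unitob C) f = f \comp lunit A.
Proof. exact: lunit_natural. Qed.

Lemma lunitV_whisk A B (f : hom A B) :
  whisk (unitob C) f \comp lunitV A = lunitV B \comp f.
Proof. exact: inverses_swap (lunitK _) (lunitK _) (lunit_whisk _). Qed.

Lemma pentagon_act A B P Q :
  assoc A B (P \ox Q) \comp assoc (A \ox B) P Q
    = whisk A (assoc B P Q) \comp (assoc A (B \ox P) Q
        \comp act (assoc A B P) Q).
Proof. by rewrite compmA; exact: pentagon. Qed.

Lemma triangle_act A B :
  act (runit A) B = whisk A (lunit B) \comp assoc A (unitob C) B.
Proof. exact: esym (triangle _ _). Qed.

Lemma whisk_unit_inj A B (f g : hom A B) :
  whisk (unitob C) f = whisk (unitob C) g -> f = g.
Proof.
move=> e; apply: (inverses_cancelr (lunitK A)).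
by rewrite -!lunit_whisk e.
Qed.

Lemma whisk_inverses A S T (f : hom S T) g :
  inverses f g -> inverses (whisk A f) (whisk A g).
Proof. by case=> gf fg; split; rewrite -whiskM ?gf ?fg whisk1. Qed.

Lemma act_inverses A B T (f : hom A B) g :
  inverses f g -> inverses (act f T) (act g T).
Proof. by case=> gf fg; split; rewrite -actM ?gf ?fg act1. Qed.

Lemma inverses_sym A B (f : hom A B) g : inverses f g -> inverses g f.
Proof. by case. Qed.

(* Kelly's coherence lemma. *)
Lemma lunit_assoc A T :
  lunit (A \ox T) \comp assoc (unitob C) A T = act (lunit A) T.
Proof.
(* Tensoring with the unit is faithful; after it, the claim is the pentagon for the unit, the unit,
   [A] and [T], with the triangle axiom absorbing the unit constraints. *)
apply: whisk_unit_inj.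
apply: (inverses_cancelr (assocK (unitob C) (unitob C \ox A) T)).
apply: (inverses_cancelr (act_inverses T (assocK (unitob C) (unitob C) A))).
rewrite whiskM -!compmA -pentagon_act.
rewrite compmA -triangle_act -assoc_act2 triangle_act actM.
by rewrite (compR22 (assoc_act_whisk _ _ _)).
Qed.

Lemma lunitV_assoc A T :
  assoc (unitob C) A T \comp act (lunitV A) T = lunitV (A \ox T).
Proof.
apply: (inverses_cancell (lunitK _)); rewrite lunitlunitV compmA lunit_assoc.
by rewrite -actM lunitlunitV act1.
Qed.

(* The composites below are locked so that rewriting with associativity of
   composition does not unfold them. *)
Fact composite_key : unit. Proof. by []. Qed.

Definition evT P Q (e : hom (P \ox Q) (unitob C)) T : hom (P \ox (Q \ox T)) T :=
  locked_with composite_key (lunit T \comp (act e T \comp assocV P Q T)).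

Lemma evTE P Q (e : hom (P \ox Q) (unitob C)) T :
  evT e T = lunit T \comp (act e T \comp assocV P Q T).
Proof. by rewrite /evT unlock. Qed.

Definition coT P Q (c : hom (unitob C) (P \ox Q)) T : hom T (P \ox (Q \ox T)) :=
  locked_with composite_key (assoc P Q T \comp (act c T \comp lunitV T)).

Lemma coTE P Q (c : hom (unitob C) (P \ox Q)) T :
  coT c T = assoc P Q T \comp (act c T \comp lunitV T).
Proof. by rewrite /coT unlock. Qed.

Lemma evT_natural P Q (e : hom (P \ox Q) (unitob C)) S T (f : hom S T) :
  evT e T \comp whisk P (whisk Q f) = f \comp evT e S.
Proof.
rewrite !evTE -!compmA -assocV_whisk (compR22 (act_whisk _ _)).
by rewrite (compR22 (lunit_whisk _)).
Qed.

Lemma coT_natural P Q (c : hom (unitob C) (P \ox Q)) S T (f : hom S T) :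
  whisk P (whisk Q f) \comp coT c S = coT c T \comp f.
Proof.
rewrite !coTE -?compmA (compR22 (esym (assoc_whisk _ _ _))).
by rewrite (compR22 (esym (act_whisk _ _))) -?compmA lunitV_whisk.
Qed.

End MonoidalTheory.

Section Duality.
Variables (K : fieldType) (C : monCat K).
Implicit Types P Q S T U : C.

Lemma pentagonV A B P Q :
  whisk A (assocV B P Q) \comp (assoc A B (P \ox Q) \comp assoc (A \ox B) P Q)
    = assoc A (B \ox P) Q \comp act (assoc A B P) Q :> hom (_ : C) _.
Proof.
by rewrite pentagon_act compmA -whiskM assocVassoc whisk1 comp1m.
Qed.

Lemma pentagonV2 A B P Q :
  assoc (A \ox B) P Q \comp act (assocV A B P) Q
    = assocV A B (P \ox Q) \comp (whisk A (assoc B P Q) \comp assoc A (B \ox P) Q)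
    :> hom (_ : C) _.
Proof.
apply: (inverses_cancell (assocK _ _ _)).
apply: (inverses_cancelr (act_inverses Q (assocK _ _ _))).
rewrite -?compmA -actM assocVassoc act1 compm1 (compR21 (assocassocV _ _ _)) comp1m.
by rewrite -pentagon_act.
Qed.

Lemma triangleV A B :
  assoc A (unitob C) B \comp act (runitV A) B = whisk A (lunitV B).
Proof.
apply: (inverses_cancell (whisk_inverses A (lunitK B))).
by rewrite -whiskM lunitlunitV whisk1 compmA -triangle_act -actM runitrunitV act1.
Qed.

Variables (A A' : C) (ev : hom (A' \ox A) (unitob C)).
Variable coev : hom (unitob C) (A \ox A').
Hypothesis dualA : is_duality ev coev.

(** The first duality equation tensored with [T]: pentagon and triangle absorb its associator and
    unit constraints into [evT] and [coT]. *)
Lemma zigzag1 T : whisk A (evT ev T) \comp coT coev (A \ox T) = idm _.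
Proof.
have [zz _] := dualA.
have {}zz : runit A \comp (whisk A ev \comp (assoc A A' A
    \comp (act coev A \comp lunitV A))) = idm A by rewrite !compmA.
have := congr1 (fun f => act f T) zz.
rewrite act1 => <-; rewrite !actM -?compmA triangle_act.
rewrite -?compmA (compR22 (assoc_act_whisk _ _ _)) (compR22 (esym (pentagonV _ _ _ _))).
rewrite -?compmA (compR22 (assoc_act2 _ _ _)) lunitV_assoc.
by rewrite evTE coTE !whiskM -?compmA.
Qed.

Lemma zigzag2 T : evT ev (A' \ox T) \comp whisk A' (coT coev T) = idm _.
Proof.
have [_ zz] := dualA.
have {}zz : lunit A' \comp (act ev A' \comp (assocV A' A A'
    \comp (whisk A' coev \comp runitV A'))) = idm A' by rewrite !compmA.
have := congr1 (fun f => act f T) zz.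
rewrite act1 => <-; rewrite !actM -?compmA -lunit_assoc evTE coTE -?compmA.
congr (_ \comp _).
rewrite (compR22 (assoc_act2 _ _ _)) (compR22 (pentagonV2 _ _ _ _)) -?compmA.
by rewrite (compR22 (assoc_act_whisk _ _ _)) triangleV !whiskM.
Qed.

End Duality.

(** * Braiding and traces *)

Section Braiding.
Variables (K : fieldType) (C : braidedFusionCat K).
Implicit Types A B E P Q S T U : C.

Lemma pentagonV3 A B P Q :
  act (assoc A B P) Q \comp assocV (A \ox B) P Q
    = assocV A (B \ox P) Q \comp (whisk A (assocV B P Q)
        \comp assoc A B (P \ox Q)) :> hom _ (_ : C).
Proof.
apply: (inverses_cancell (assocK _ _ _)).
apply: (inverses_cancelr (assocK _ _ _)).
rewrite -?compmA assocVassoc compm1 (compR21 (assocassocV _ _ _)) comp1m.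
by rewrite pentagonV.
Qed.

Lemma pentagonV4 A B P Q :
  act (assocV A B P) Q \comp assocV A (B \ox P) Q
    = assocV (A \ox B) P Q \comp (assocV A B (P \ox Q)
        \comp whisk A (assoc B P Q)) :> hom _ (_ : C).
Proof.
apply: (inverses_cancell (act_inverses Q (assocK _ _ _))).
rewrite (compR22 (pentagonV3 _ _ _ _)) -?compmA.
rewrite (compR21 (assocassocV _ _ _)) comp1m -whiskM assocVassoc whisk1 compm1.
by rewrite compmA -actM assocassocV act1 comp1m.
Qed.

(** The crossing of the two leftmost strands, conjugated by associators so that it acts on words
    bracketed to the right. *)
Definition braidT E P T : hom (E \ox (P \ox T)) (P \ox (E \ox T)) :=
  locked_with composite_key
    (assoc P E T \comp (act (braid E P) T \comp assocV E P T)).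

Lemma braidTE E P T :
  braidT E P T = assoc P E T \comp (act (braid E P) T \comp assocV E P T).
Proof. by rewrite /braidT unlock. Qed.

Lemma braidT_iso E P T : exists g, inverses (braidT E P T) g.
Proof.
have [c cK] := braid_iso E P.
exists (assoc E P T \comp (act c T \comp assocV P E T)).
have [h1 h2] := act_inverses T cK; rewrite braidTE; split; rewrite -?compmA.
  by rewrite (compR21 (assocVassoc _ _ _)) comp1m (compR21 h1) comp1m assocassocV.
by rewrite (compR21 (assocVassoc _ _ _)) comp1m (compR21 h2) comp1m assocassocV.
Qed.

Lemma braidT_natural E P S T (f : hom S T) :
  braidT E P T \comp whisk E (whisk P f) = whisk P (whisk E f) \comp braidT E P S.
Proof.
rewrite !braidTE -?compmA -assocV_whisk (compR22 (act_whisk _ _)).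
by rewrite (compR22 (assoc_whisk _ _ _)).
Qed.

Lemma braid_actl E E' P (f : hom E E') :
  braid E' P \comp act f P = whisk P f \comp braid E P.
Proof. exact: braid_natural. Qed.

Lemma braid_whiskr E P P' (f : hom P P') :
  braid E P' \comp whisk E f = act f E \comp braid E P.
Proof. exact: braid_natural. Qed.

Lemma braidT_actl E E' P T (f : hom E E') :
  braidT E' P T \comp act f (P \ox T) = whisk P (act f T) \comp braidT E P T.
Proof.
rewrite !braidTE -?compmA -assocV_act2 -(compR22 (assoc_act_whisk _ _ _)).
by rewrite (compR21 (esym (actM _ _ _))) braid_actl actM -?compmA.
Qed.

Lemma braidT_whiskr E P P' T (f : hom P P') :
  braidT E P' T \comp whisk E (act f T) = act f (E \ox T) \comp braidT E P T.
Proof.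
rewrite !braidTE -?compmA -assocV_act_whisk -(compR22 (assoc_act2 _ _ _)).
by rewrite (compR21 (esym (actM _ _ _))) braid_whiskr actM -?compmA.
Qed.

Lemma hexagon1_act A P Q :
  assoc P Q A \comp (braid A (P \ox Q) \comp assoc A P Q)
    = whisk P (braid A Q) \comp (assoc P A Q \comp act (braid A P) Q).
Proof. by rewrite !compmA; exact: hexagon1. Qed.

(** This is [hexagon1] for words bracketed to the right: passing [P \ox Q] is passing [P] and then
    [Q]. Pentagons absorb the associators. *)
Lemma braidT_tensr E P Q T :
  assoc P Q (E \ox T) \comp braidT E (P \ox Q) T
    = whisk P (braidT E Q T) \comp (braidT E P (Q \ox T) \comp whisk E (assoc P Q T)).
Proof.
apply: (inverses_cancelr (assocK E (P \ox Q) T)).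
apply: (inverses_cancelr (act_inverses T (assocK E P Q))).
rewrite !braidTE -?compmA (compR21 (assocVassoc _ _ _)) comp1m.
rewrite (compR22 (pentagon_act _ _ _ _)) -?compmA -!actM hexagon1_act.
rewrite !whiskM -?compmA; congr (_ \comp _).
rewrite !actM (compR22 (assoc_act_whisk _ _ _)); congr (_ \comp _).
rewrite -pentagon_act (compR21 (assocVassoc _ _ _)) comp1m.
rewrite -assoc_act2 (compR22 (pentagon_act _ _ _ _)) -?compmA.
by rewrite (compR21 (esym (whiskM _ _ _))) assocVassoc whisk1 comp1m.
Qed.

Lemma braidT_tensrV E P Q T :
  braidT E (P \ox Q) T \comp whisk E (assocV P Q T)
    = assocV P Q (E \ox T) \comp (whisk P (braidT E Q T) \comp braidT E P (Q \ox T)).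
Proof.
apply: (inverses_cancell (assocK P Q (E \ox T))).
rewrite (compR21 (assocassocV _ _ _)) comp1m (compR21 (braidT_tensr _ _ _ _)) -?compmA.
by rewrite -whiskM assocassocV whisk1 compm1.
Qed.

Lemma braidT_tensl A B P T :
  whisk P (assoc A B T) \comp braidT (A \ox B) P T
    = braidT A P (B \ox T) \comp (whisk A (braidT B P T) \comp assoc A B (P \ox T)).
Proof.
(* [hexagon2] solved for the braiding of the tensor product. *)
have hex : braid (A \ox B) P = assoc P A B \comp (act (braid A P) B
    \comp (assocV A P B \comp (whisk A (braid B P) \comp assoc A B P))).
  apply: (inverses_cancell (inverses_sym (assocK P A B))).
  apply: (inverses_cancelr (inverses_sym (assocK A B P))).
  rewrite hexagon2 -?compmA assocassocV compm1.
  by rewrite (compR21 (assocVassoc _ _ _)) comp1m.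
rewrite !braidTE hex !actM -?compmA.
have pent D (k : hom D _) : whisk P (assoc A B T) \comp (assoc P (A \ox B) T
    \comp (act (assoc P A B) T \comp k))
    = assoc P A (B \ox T) \comp (assoc (P \ox A) B T \comp k).
  by rewrite (compR22 (pentagon_act _ _ _ _)) -?compmA.
rewrite pent pentagonV3 (compR22 (assocV_act_whisk _ _ _)) (compR22 (pentagonV4 _ _ _ _)).
rewrite -?compmA (compR22 (assoc_act2 _ _ _)) (compR21 (assocassocV _ _ _)) comp1m.
by rewrite !whiskM -?compmA.
Qed.

(** The hexagon forces this compatibility with the unit: crossing a product of two units is crossing
    the unit twice, and one of the crossings, being invertible, cancels. *)
Lemma braidT_unitr E T : lunit (E \ox T) \comp braidT E (unitob C) T = whisk E (lunit T).
Proof.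
have [g gK] := braidT_iso E (unitob C) (unitob C \ox T).
apply: whisk_unit_inj; apply: (inverses_cancelr gK).
rewrite whiskM -braidT_natural.
apply: (inverses_cancelr (whisk_inverses E (assocK (unitob C) (unitob C) T))).
rewrite -[RHS]compmA -[in RHS]whiskM -triangle_act braidT_whiskr triangle_act.
by rewrite -[RHS]compmA braidT_tensr !compmA.
Qed.

(** The strand of [E] slides past a cap: by naturality it may cross the unit instead of [P \ox Q],
    and that crossing is trivial by [braidT_unitr]. *)
Lemma braidT_ev E P Q (e : hom (P \ox Q) (unitob C)) T :
  evT e (E \ox T) \comp (whisk P (braidT E Q T) \comp braidT E P (Q \ox T))
    = whisk E (evT e T).
Proof.
apply: (inverses_cancelr (whisk_inverses E (assocK P Q T))).
rewrite -?compmA -braidT_tensr !evTE -?compmA (compR21 (assocVassoc _ _ _)) comp1m.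
rewrite -braidT_whiskr (compR21 (braidT_unitr _ _)).
by rewrite -!whiskM -?compmA assocVassoc compm1.
Qed.

Lemma braidT_unitrV E T :
  braidT E (unitob C) T \comp whisk E (lunitV T) = lunitV (E \ox T).
Proof.
apply: (inverses_cancell (lunitK _)).
by rewrite lunitlunitV compmA braidT_unitr -whiskM lunitlunitV whisk1.
Qed.

Lemma braidT_coev E P Q (c : hom (unitob C) (P \ox Q)) T :
  whisk P (braidT E Q T) \comp (braidT E P (Q \ox T) \comp whisk E (coT c T))
    = coT c (E \ox T).
Proof.
have tens D (k : hom D _) : whisk P (braidT E Q T) \comp (braidT E P (Q \ox T)
    \comp (whisk E (assoc P Q T) \comp k))
    = assoc P Q (E \ox T) \comp (braidT E (P \ox Q) T \comp k).
  by rewrite (compR22 (braidT_tensr _ _ _ _)) -?compmA.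
by rewrite !coTE !whiskM tens (compR22 (braidT_whiskr _ _ _)) braidT_unitrV.
Qed.

End Braiding.

(* A left dual of [A], as a functor [T |-> A' (x) T] given by families of maps in
   which no associator appears; [dual_fun] is [B' (x) (A' (x) -)] for [A (x) B]. *)
Record strictDual (K : fieldType) (C : braidedFusionCat K) (A : C) := StrictDual {
  dual_fun : C -> C;
  dual_map : forall S T, hom S T -> hom (dual_fun S) (dual_fun T);
  cup : forall T, hom T (A \ox dual_fun T);
  cap : forall T, hom (dual_fun (A \ox T)) T;
  cross : forall E T, hom (E \ox dual_fun T) (dual_fun (E \ox T));
  dual_map1 : forall T, dual_map (idm T) = idm _;
  dual_mapM : forall S T U (g : hom T U) (f : hom S T),
    dual_map (g \comp f) = dual_map g \comp dual_map f;
  cup_natural : forall S T (f : hom S T),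
    whisk A (dual_map f) \comp cup S = cup T \comp f;
  cap_natural : forall S T (f : hom S T),
    cap T \comp dual_map (whisk A f) = f \comp cap S;
  cup_cap : forall T, whisk A (cap T) \comp cup (A \ox T) = idm _;
  cross_natural : forall E S T (f : hom S T),
    cross E T \comp whisk E (dual_map f) = dual_map (whisk E f) \comp cross E S;
  cross_act : forall E E' (f : hom E E') T,
    cross E' T \comp act f (dual_fun T) = dual_map (act f T) \comp cross E T;
  cross_cup : forall E T, whisk A (cross E T) \comp (braidT E A (dual_fun T)
    \comp whisk E (cup T)) = cup (E \ox T);
  cross_cap : forall E T, cap (E \ox T) \comp (dual_map (braidT E A T)
    \comp cross E (A \ox T)) = whisk E (cap T) }.

(** * Transposes of morphisms between objects with duals *)

Section Mates.
Variables (K : fieldType) (C : braidedFusionCat K) (A B : C).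
Variables (G : strictDual A) (H : strictDual B) (f : hom A B).
Implicit Types E S T : C.

(** The transpose of [f]. For [f] an identity it compares two duals of one object, as in
    [encircle_indep]. *)
Definition mate T : hom (dual_fun H T) (dual_fun G T) :=
  locked_with composite_key (cap H (dual_fun G T)
    \comp (dual_map H (act f (dual_fun G T)) \comp dual_map H (cup G T))).

Lemma mateE T : mate T = cap H (dual_fun G T)
    \comp (dual_map H (act f (dual_fun G T)) \comp dual_map H (cup G T)).
Proof. by rewrite /mate unlock. Qed.

Lemma mate_cup T :
  whisk B (mate T) \comp cup H T = act f (dual_fun G T) \comp cup G T.
Proof.
rewrite mateE !whiskM -?compmA cup_natural (compR22 (cup_natural _ _)).
by rewrite (compR21 (cup_cap _ _)) comp1m.
Qed.

Lemma cap_mate T :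
  cap G T \comp mate (A \ox T) = cap H T \comp dual_map H (act f T).
Proof.
rewrite mateE (compR22 (esym (cap_natural _ _))).
rewrite (compR21 (esym (dual_mapM _ _ _))) -act_whisk -dual_mapM -compmA cup_cap.
by rewrite compm1.
Qed.

(** The transpose is made of a cup, [f] and a cap; the strand of [E] passes them by [cross_cup],
    [braidT_whiskr] and [cross_cap] respectively. *)
Lemma cross_mate E T :
  cross G E T \comp whisk E (mate T) = mate (E \ox T) \comp cross H E T.
Proof.
rewrite !mateE !whiskM -(cross_cup G) !dual_mapM -?compmA -cross_natural.
rewrite (compR21 (esym (dual_mapM _ _ _))) act_whisk dual_mapM -?compmA.
rewrite (compR22 (cap_natural _ _)) -?compmA; congr (_ \comp _).
rewrite (compR21 (esym (dual_mapM _ (act f _) _))) -braidT_whiskr dual_mapM -?compmA.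
rewrite -(compR22 (cross_natural _ _ _)) -(cross_cap H) -?compmA.
by [].
Qed.

End Mates.

Section Traces.
Variables (K : fieldType) (C : ribbonFusionCat K).
Implicit Types A B E P Q S T U : C.

(** The quantum trace as a closed strand beside a spectator [T], for an arbitrary dual [G]. The
    freedom in [G] lets a trace over a tensor product be computed with nested duals. *)
Definition loop A (G : strictDual A) (f : hom A A) T : hom T T :=
  cap G T \comp (cross G A T
    \comp (act (twist A \comp f) (dual_fun G T) \comp cup G T)).

(** [f] travels around the loop: at the cup it turns into its transpose, which passes the crossing
    and turns back into [f] at the cap; naturality of the twist completes the exchange. With [f] an
    identity, this shows that the loop does not depend on the dual. *)
Lemma loop_cyclic A B (G : strictDual A) (H : strictDual B)
    (f : hom A B) (g : hom B A) T :
  loop G (g \comp f) T = loop H (f \comp g) T.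
Proof.
rewrite /loop !actM -?compmA -(mate_cup G H).
rewrite (compR22 (act_whisk _ _)) (compR22 (act_whisk _ _)).
rewrite (compR22 (cross_mate G H _ _ _)).
rewrite (compR22 (cap_mate G H _ _)) -(compR22 (cross_act _ _ _)).
by rewrite (compR21 (esym (actM _ _ _))) -twist_natural actM -?compmA.
Qed.

Lemma loop_sum A (G : strictDual A) n (f : 'I_n -> hom A A) T :
  loop G (\sum_i f i) T = \sum_i loop G (f i) T.
Proof. by rewrite /loop comp_sumr /act tensm_suml comp_suml !comp_sumr. Qed.

End Traces.

Section DualOfObject.
Variables (K : fieldType) (C : braidedFusionCat K) (A A' : C).
Variables (ev : hom (A' \ox A) (unitob C)) (coev : hom (unitob C) (A \ox A')).
Hypothesis dualA : is_duality ev coev.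

Program Definition strict_dual : strictDual A :=
  @StrictDual K C A (fun T => A' \ox T) (whisk A') (coT coev) (evT ev)
    (fun E T => braidT E A' T) (whisk1 A') (whiskM A') _ _ _ _ _ _ _.
Next Obligation. exact: coT_natural. Qed.
Next Obligation. exact: evT_natural. Qed.
Next Obligation. exact: zigzag1. Qed.
Next Obligation. exact: braidT_natural. Qed.
Next Obligation. exact: braidT_actl. Qed.
Next Obligation. exact: braidT_coev. Qed.
Next Obligation. exact: braidT_ev. Qed.

End DualOfObject.

Section DualOfTensor.
Variables (K : fieldType) (C : braidedFusionCat K) (A B : C).
Variables (G : strictDual A) (H : strictDual B).

(** Used in place of the chosen [dual (A \ox B)]: since loops do not depend on the dual, no
    isomorphism between that object and the product of the duals has to be constructed. *)
Program Definition strict_dual_tens : strictDual (A \ox B) :=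
  @StrictDual K C (A \ox B) (fun T => dual_fun H (dual_fun G T))
    (fun S T f => dual_map H (dual_map G f))
    (fun T => assocV A B _ \comp (whisk A (cup H (dual_fun G T)) \comp cup G T))
    (fun T => cap H T \comp (dual_map H (cap G (B \ox T))
       \comp dual_map H (dual_map G (assoc A B T))))
    (fun E T => dual_map H (cross G E T) \comp cross H E (dual_fun G T))
    _ _ _ _ _ _ _ _ _.
Next Obligation. by rewrite !dual_map1. Qed.
Next Obligation. by rewrite !dual_mapM. Qed.
Next Obligation.
rewrite (compR22 (assocV_whisk _ _ _)) -?compmA; congr (_ \comp _).
by rewrite (compR21 (esym (whiskM _ _ _))) cup_natural whiskM -?compmA cup_natural.
Qed.
Next Obligation.
rewrite -?compmA -!dual_mapM assoc_whisk !dual_mapM.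
rewrite (compR21 (esym (dual_mapM H _ _))) cap_natural dual_mapM -?compmA.
by rewrite (compR22 (cap_natural _ _)).
Qed.
Next Obligation.
rewrite (compR22 (assocV_whisk _ _ _)) !whiskM -?compmA.
rewrite (compR21 (esym (whiskM A _ (cup H _)))) cup_natural whiskM -?compmA.
rewrite (compR21 (esym (whiskM A _ (cup H _)))) cup_natural whiskM -?compmA.
rewrite (compR21 (esym (whiskM A _ (cup H _)))) cup_cap whisk1 comp1m.
by rewrite cup_natural (compR21 (cup_cap _ _)) comp1m assocVassoc.
Qed.
Next Obligation.
rewrite -?compmA cross_natural (compR21 (esym (dual_mapM _ _ _))) cross_natural.
by rewrite dual_mapM -?compmA.
Qed.
Next Obligation.
rewrite -?compmA cross_act (compR21 (esym (dual_mapM _ _ _))) cross_act.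
by rewrite dual_mapM -?compmA.
Qed.
Next Obligation.
rewrite !whiskM -?compmA (compR22 (braidT_tensrV _ _ _ _)) -?compmA.
rewrite (compR22 (assocV_whisk _ _ _)) (compR22 (assocV_whisk _ _ _)).
congr (_ \comp _); rewrite (compR22 (braidT_natural _ _ _)).
have h S D (k : hom D _) : whisk A (whisk B (cross H E S))
    \comp (whisk A (braidT E B (dual_fun H S)) \comp (whisk A (whisk E (cup H S))
      \comp k)) = whisk A (cup H (E \ox S)) \comp k.
  rewrite (compR21 (esym (whiskM _ _ _))) (compR21 (esym (whiskM _ _ _))).
  by rewrite -compmA cross_cup.
rewrite h (compR21 (esym (whiskM A _ (cup H _)))) cup_natural whiskM -?compmA.
by rewrite cross_cup.
Qed.
Next Obligation.
have h D (k : hom D _) : dual_map H (dual_map G (assoc A B (E \ox T)))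
    \comp (dual_map H (dual_map G (braidT E (A \ox B) T)) \comp k)
    = dual_map H (dual_map G (whisk A (braidT E B T))) \comp
      (dual_map H (dual_map G (braidT E A (B \ox T))) \comp
       (dual_map H (dual_map G (whisk E (assoc A B T))) \comp k)).
  by rewrite !compmA -!dual_mapM braidT_tensr -?compmA.
rewrite -?compmA h.
have {}h D (k : hom D _) : dual_map H (cap G (B \ox (E \ox T))) \comp
    (dual_map H (dual_map G (whisk A (braidT E B T))) \comp
      (dual_map H (dual_map G (braidT E A (B \ox T))) \comp
       (dual_map H (dual_map G (whisk E (assoc A B T))) \comp
         (dual_map H (cross G E (A \ox B \ox T)) \comp k))))
    = dual_map H (braidT E B T) \comp (dual_map H (whisk E (cap G (B \ox T)))
        \comp (dual_map H (whisk E (dual_map G (assoc A B T))) \comp k)).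
  rewrite !compmA -!dual_mapM -?compmA -cross_natural (compR22 (cap_natural _ _)).
  by rewrite -(cross_cap G) -?compmA.
rewrite h -cross_natural.
by rewrite -(compR22 (cross_natural _ _ _)) !whiskM -(cross_cap H) -?compmA.
Qed.

End DualOfTensor.

Section YangBaxter.
Variables (K : fieldType) (C : braidedFusionCat K).
Implicit Types A B P S T U : C.

Lemma braidT_tenslV A B P T D (k : hom D _) :
  braidT A P (B \ox T) \comp (whisk A (braidT B P T) \comp k)
  = whisk P (assoc A B T) \comp (braidT (A \ox B) P T
      \comp (assocV A B (P \ox T) \comp k)).
Proof.
rewrite (compR22 (braidT_tensl _ _ _ _)) -?compmA (compR21 (assocassocV _ _ _)) comp1m.
by [].
Qed.

(** The strands of [A] and [B] cross [P] together, and this crossing is natural in the morphism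
    [braid B A]. *)
Lemma yang_baxter A B P U :
  braidT A P (B \ox U) \comp (whisk A (braidT B P U) \comp braidT B A (P \ox U))
  = whisk P (braidT B A U) \comp (braidT B P (A \ox U) \comp whisk B (braidT A P U)).
Proof.
rewrite braidT_tenslV -[whisk B _]compm1 braidT_tenslV compm1.
rewrite [braidT B A (P \ox U)]braidTE [braidT B A U]braidTE.
rewrite (compR21 (assocVassoc _ _ _)) comp1m.
rewrite (compR22 (braidT_actl _ _ _)) !whiskM -?compmA.
rewrite (compR21 (esym (whiskM _ (assocV _ _ _) _))) assocVassoc whisk1 comp1m.
by [].
Qed.

End YangBaxter.

Section TraceOfTensor.
Variables (K : fieldType) (C : ribbonFusionCat K).
Implicit Types A B E P Q S T U X Y Z : C.

Definition std_dual A : strictDual A := strict_dual (dualP A).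

Definition rtev A : hom (A \ox dual A) (unitob C) :=
  ev A \comp (braid A (dual A) \comp act (twist A) (dual A)).

(** The cap that closes a strand opened by [etaT]: it pairs [A] with a dual standing on its right,
    so the braiding and the twist are built in. *)
Definition epsT A T : hom (A \ox (dual A \ox T)) T :=
  locked_with composite_key (evT (rtev A) T).
Definition etaT A T : hom T (A \ox (dual A \ox T)) :=
  locked_with composite_key (coT (coev A) T).

Lemma epsT_evT A T : epsT A T = evT (rtev A) T.
Proof. by rewrite /epsT unlock. Qed.

Lemma etaTE A T : etaT A T = coT (coev A) T.
Proof. by rewrite /etaT unlock. Qed.

Lemma epsTE A T : epsT A T
  = evT (ev A) T \comp (braidT A (dual A) T \comp act (twist A) (dual A \ox T)).
Proof.
rewrite epsT_evT !evTE braidTE !actM -?compmA (compR21 (assocVassoc _ _ _)) comp1m.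
by rewrite assocV_act2.
Qed.

Lemma epsT_natural A S T (f : hom S T) :
  epsT A T \comp whisk A (whisk (dual A) f) = f \comp epsT A S.
Proof. by rewrite !epsT_evT evT_natural. Qed.

Lemma etaT_natural A S T (f : hom S T) :
  whisk A (whisk (dual A) f) \comp etaT A S = etaT A T \comp f.
Proof. by rewrite !etaTE coT_natural. Qed.

Lemma braidT_epsT E A T :
  epsT A (E \ox T) \comp (whisk A (braidT E (dual A) T) \comp braidT E A (dual A \ox T))
    = whisk E (epsT A T).
Proof. by rewrite !epsT_evT braidT_ev. Qed.

Lemma loop_std A (f : hom A A) T :
  loop (std_dual A) f T
  = epsT A T \comp (act f (dual A \ox T) \comp etaT A T).
Proof. by rewrite /loop epsTE etaTE actM -?compmA. Qed.

Lemma twist_tens_assoc A B S D (k : hom D _) :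
  assoc A B S \comp (act (twist (A \ox B)) S \comp k)
  = act (twist A) _ \comp (whisk A (act (twist B) S) \comp
      (braidT B A S \comp (braidT A B S \comp (assoc A B S \comp k)))).
Proof.
rewrite twist_tens tensm_act !actM -?compmA.
rewrite (compR22 (assoc_act2 _ _ _)) (compR22 (assoc_act_whisk _ _ _)) !braidTE -?compmA.
by do 2 rewrite (compR21 (assocVassoc _ _ _)) comp1m.
Qed.

(* The strand of [A], closed against its dual by [epsT], is pulled off the
   strand of [B]. *)
Lemma epsT_tens A B T D (k : hom D _) :
  evT (ev B) T \comp (whisk (dual B) (evT (ev A) (B \ox T))
    \comp (whisk (dual B) (whisk (dual A) (assoc A B T))
    \comp (whisk (dual B) (braidT (A \ox B) (dual A) T)
    \comp (braidT (A \ox B) (dual B) (dual A \ox T)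
    \comp (act (twist (A \ox B)) _ \comp k)))))
  = epsT A T \comp (whisk A (epsT B (dual A \ox T)) \comp (assoc A B _ \comp k)).
Proof.
set A' := dual A; set B' := dual B; set U := A' \ox T.
rewrite (compR21 (esym (whiskM _ (whisk _ _) _))) braidT_tensl !whiskM -?compmA.
rewrite (compR22 (braidT_tensl _ _ _ _)) -?compmA twist_tens_assoc.
move: (assoc A B _ \comp k) => {}k.
rewrite -(compR22 (act_whisk _ _)) (compR22 (braidT_actl _ _ _)).
have e1 : whisk B' (whisk A (braidT B A' T)) \comp whisk B' (act (twist A) (B \ox U))
   = whisk B' (act (twist A) _) \comp whisk B' (whisk A (braidT B A' T)).
  by rewrite -!whiskM act_whisk.
rewrite (compR22 e1).
have e2 : whisk B' (evT (ev A) (B \ox T)) \comp (whisk B' (braidT A A' (B \ox T))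
    \comp whisk B' (act (twist A) (A' \ox (B \ox T)))) = whisk B' (epsT A (B \ox T)).
  by rewrite -!whiskM epsTE.
rewrite (compR31 e2).
rewrite -(compR22 (braidT_actl _ _ (twist B))).
(* The twist of [A \ox B] makes the two strands cross twice. Yang-Baxter brings one of these
   crossings next to that of [B] with the dual of [A], where [braidT_epsT] applies; the other one is
   left for the cap of [B]. *)
rewrite (compR31 (yang_baxter _ _ _ _)) -?compmA.
have e3 : whisk B' (epsT A (B \ox T)) \comp (whisk B' (whisk A (braidT B A' T))
    \comp whisk B' (braidT B A U)) = whisk B' (whisk B (epsT A T)).
  by rewrite -!whiskM braidT_epsT.
rewrite (compR31 e3) -(compR22 (braidT_natural _ _ _)) -(compR22 (act_whisk _ _)).
rewrite -(compR22 (act_whisk _ _)).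
rewrite (compR31 (esym (epsTE _ _))) (compR22 (epsT_natural _ _)).
by rewrite (compR31 (braidT_epsT _ _ _)).
Qed.

Lemma loop_tens A B (f : hom (A \ox B) (A \ox B)) T :
  loop (strict_dual_tens (std_dual A) (std_dual B)) f T
  = epsT A T \comp (whisk A (epsT B (dual A \ox T))
     \comp (assoc A B _ \comp (act f _ \comp (assocV A B _
       \comp (whisk A (etaT B (dual A \ox T)) \comp etaT A T))))).
Proof. by rewrite /loop /= -?compmA actM -?compmA epsT_tens !etaTE. Qed.

End TraceOfTensor.

(** * Closed strands around a strand: the scalars behind the S-matrix *)

Section PartialTrace.
Variables (K : fieldType) (C : ribbonFusionCat K).
Implicit Types A B E P Q S T U X Y Z : C.

Lemma coT_rlinear P Q (c : hom (unitob C) (P \ox Q)) U T :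
  whisk P (assoc Q U T) \comp (assoc P (Q \ox U) T \comp act (coT c U) T)
    = coT c (U \ox T).
Proof.
rewrite !coTE !actM (compR31 (esym (pentagon_act _ _ _ _))) -?compmA.
by rewrite (compR22 (assoc_act2 _ _ _)) lunitV_assoc.
Qed.

Lemma evT_rlinear P Q (e : hom (P \ox Q) (unitob C)) U T :
  evT e (U \ox T) \comp (whisk P (assoc Q U T) \comp assoc P (Q \ox U) T)
    = act (evT e U) T.
Proof.
rewrite !evTE !actM -?compmA -pentagonV2 -lunit_assoc -?compmA.
by rewrite (compR22 (assoc_act2 _ _ _)).
Qed.

Lemma braidT_rlinear E P U T :
  whisk P (assoc E U T) \comp (assoc P (E \ox U) T \comp act (braidT E P U) T)
    = braidT E P (U \ox T) \comp (whisk E (assoc P U T) \comp assoc E (P \ox U) T).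
Proof.
rewrite !braidTE !actM (compR31 (esym (pentagon_act _ _ _ _))) -?compmA.
by rewrite (compR22 (assoc_act2 _ _ _)) pentagonV2.
Qed.

(* The strand of [Y], encircling the strand of [X] and closed up. *)
Definition encircle X Y (G : strictDual Y) T : hom (X \ox T) (X \ox T) :=
  whisk X (cap G T \comp (cross G Y T \comp act (twist Y) (dual_fun G T)))
  \comp (braidT Y X _ \comp (braidT X Y _ \comp whisk X (cup G T))).

(** The transpose of the identity from one dual to the other appears at the cup, passes the two
    braidings and the crossing, and is absorbed at the cap. *)
Lemma encircle_indep X Y (G H : strictDual Y) T :
  encircle X G T = encircle X H T.
Proof.
have cupE : cup G T = whisk Y (mate G H (idm Y) T) \comp cup H T.
  by rewrite mate_cup act1 comp1m.
rewrite /encircle cupE [whisk X (whisk Y _ \comp _)]whiskM.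
rewrite (compR22 (braidT_natural _ _ _)) (compR22 (braidT_natural _ _ _)).
rewrite (compR21 (esym (whiskM _ _ _))) -?compmA act_whisk.
rewrite (compR22 (cross_mate G H _ _ _)).
by rewrite (compR22 (cap_mate G H _ _)) act1 dual_map1 comp1m.
Qed.

Definition encl X Y T := encircle X (std_dual Y) T.

Lemma enclE X Y T : encl X Y T = whisk X (epsT Y T)
  \comp (braidT Y X _ \comp (braidT X Y _ \comp whisk X (etaT Y T))).
Proof. by rewrite /encl /encircle /= epsTE etaTE. Qed.

Lemma encl_natural X Y S T (f : hom S T) :
  encl X Y T \comp whisk X f = whisk X f \comp encl X Y S.
Proof.
rewrite !enclE -?compmA -whiskM -etaT_natural whiskM.
rewrite (compR22 (braidT_natural _ _ _)) (compR22 (braidT_natural _ _ _)).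
by rewrite (compR21 (esym (whiskM _ _ _))) epsT_natural whiskM -?compmA.
Qed.

(** Cups, crossings and caps all commute with tensoring on the right. Together with [encl_natural],
    this determines [encl] by its component at the unit, which is an endomorphism of [X] up to
    [runit]. *)
Lemma encl_rlinear X Y U T :
  encl X Y (U \ox T) \comp assoc X U T = assoc X U T \comp act (encl X Y U) T.
Proof.
rewrite !enclE !epsT_evT !etaTE -?compmA -(coT_rlinear (coev Y) U T) !whiskM.
rewrite -?compmA -assoc_act_whisk.
have nat2 E F D (k : hom D _) :
    braidT E F (dual Y \ox (U \ox T)) \comp (whisk E (whisk F (assoc (dual Y) U T))
      \comp (whisk E (assoc F (dual Y \ox U) T)
        \comp (assoc E (F \ox (dual Y \ox U)) T \comp k)))
    = whisk F (whisk E (assoc (dual Y) U T)) \comp (whisk F (assoc E (dual Y \ox U) T)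
        \comp (assoc F (E \ox (dual Y \ox U)) T
          \comp (act (braidT E F (dual Y \ox U)) T \comp k))).
  by rewrite (compR22 (braidT_natural _ _ _)) (compR31 (braidT_rlinear _ _ _ _)) -?compmA.
rewrite !nat2 -!actM.
rewrite (compR31 (f := whisk X (evT _ _)) (l := whisk X (act (evT (rtev Y) U) T))).
  by rewrite -(compR22 (assoc_act_whisk _ _ _)) -actM.
by rewrite -evT_rlinear !whiskM.
Qed.

Lemma encl_scalar X Y : scalar_end X ->
  exists a, forall T, encl X Y T = a *: idm (X \ox T).
Proof.
move=> /(_ (runit X \comp (encl X Y (unitob C) \comp runitV X))) [a aE].
exists a => T.
have e1 : encl X Y (unitob C) = a *: idm _.
  apply: (inverses_cancell (runitK X)).
  apply: (inverses_cancelr (inverses_sym (runitK X))).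
  by rewrite -compmA aE compZr compm1 compZl runitrunitV.
have e2 : encl X Y (unitob C \ox T) = a *: idm _.
  apply: (inverses_cancelr (assocK X (unitob C) T)).
  by rewrite encl_rlinear e1 /act tensmZl tensm1 compZr compZl compm1 comp1m.
apply: (inverses_cancelr (whisk_inverses X (lunitK T))).
by rewrite encl_natural e2 compZr compZl compm1 comp1m.
Qed.

(** The strand of [Y \ox Z] is closed with nested duals, and [epsT_tens] separates it into a circle
    of [Z] around [X] inside a circle of [Y]. *)
Lemma encl_tens X Y Z T :
  encl X (Y \ox Z) T = whisk X (epsT Y T) \comp (braidT Y X _ \comp
    (whisk Y (encl X Z (dual Y \ox T)) \comp (braidT X Y _ \comp whisk X (etaT Y T)))).
Proof.
rewrite [in RHS]enclE /encl
  (encircle_indep _ _ (strict_dual_tens (std_dual Y) (std_dual Z))).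
rewrite /encircle /=.
have -> : evT (ev Z) T \comp (whisk (dual Z) (evT (ev Y) (Z \ox T)) \comp
      whisk (dual Z) (whisk (dual Y) (assoc Y Z T))) \comp
     (whisk (dual Z) (braidT (Y \ox Z) (dual Y) T) \comp
      braidT (Y \ox Z) (dual Z) (dual Y \ox T) \comp act (twist (Y \ox Z)) _)
   = epsT Y T \comp (whisk Y (epsT Z (dual Y \ox T)) \comp assoc Y Z _).
  by rewrite -?compmA -[act _ _]compm1 epsT_tens compm1.
rewrite !whiskM -?compmA (compR22 (braidT_tensl _ _ _ _)) -?compmA.
rewrite (compR22 (braidT_tensrV _ _ _ _)) -?compmA (compR21 (assocassocV _ _ _)) comp1m.
rewrite -!etaTE; congr (_ \comp _).
by rewrite (compR22 (braidT_natural _ _ _)) (compR22 (braidT_natural _ _ _)).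
Qed.

Lemma loop_monodromy X Y T :
  loop (strict_dual_tens (std_dual X) (std_dual Y))
    (braid Y X \comp braid X Y) T
  = epsT X T \comp (encl X Y (dual X \ox T) \comp etaT X T).
Proof.
rewrite loop_tens enclE -?compmA !braidTE -?compmA.
by rewrite (compR21 (assocVassoc _ _ _)) comp1m actM -?compmA.
Qed.

Definition monodromy_trace X Y : K := qtrace (braid Y X \comp braid X Y).
Definition qdim X : K := qtrace (idm X).

Hypotheses (unit_scalar : scalar_end (unitob C)) (unit_neq0 : idm (unitob C) <> 0).

Lemma end_unit_scalarP (f : hom (unitob C) (unitob C)) :
  f = end_unit_scalar f *: idm (unitob C).
Proof.
have [a ->] := unit_scalar f; congr (_ *: _).
have fr : free [tuple idm (unitob C)].
  by rewrite /= seq1_free; apply/eqP.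
have coord1 : coord [tuple idm (unitob C)] ord0 (idm (unitob C)) = 1 :=
  coord_free ord0 ord0 fr.
by rewrite /end_unit_scalar linearZ /= coord1 mulr1.
Qed.

Lemma qtraceE A (f : hom A A) T : loop (std_dual A) f T = qtrace f *: idm T.
Proof.
rewrite loop_std epsT_evT etaTE evTE coTE -?compmA.
rewrite -(compR22 (assocV_act2 _ _ _)) (compR21 (assocVassoc _ _ _)) comp1m.
rewrite (compR21 (esym (actM _ _ _))) (compR21 (esym (actM _ _ _))) -compmA.
rewrite /qtrace; set g := (X in end_unit_scalar X).
have -> : rtev A \comp (act f (dual A) \comp coev A) = g.
  by rewrite /g /rtev -/(act _ (dual A)) actM -?compmA.
rewrite {1}[g]end_unit_scalarP /act tensmZl tensm1 compZl compZr comp1m.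
by rewrite lunitlunitV.
Qed.

Lemma idm_unit_inj a b : a *: idm (unitob C) = b *: idm (unitob C) -> a = b.
Proof.
move/eqP; rewrite -subr_eq0 -scalerBl scaler_eq0 => /orP[|/eqP //].
by rewrite subr_eq0 => /eqP.
Qed.

Lemma qtrace_loop A (G : strictDual A) (f : hom A A) T :
  loop G f T = qtrace f *: idm T.
Proof.
by rewrite -qtraceE -[f]comp1m (loop_cyclic G (std_dual A)) compm1 comp1m.
Qed.

Lemma qtrace_cyclic A B (f : hom A B) (g : hom B A) :
  qtrace (g \comp f) = qtrace (f \comp g).
Proof. by apply: idm_unit_inj; rewrite -!qtraceE; apply: loop_cyclic. Qed.

Lemma qtrace_sum A n (f : 'I_n -> hom A A) :
  qtrace (\sum_i f i) = \sum_i qtrace (f i).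
Proof.
apply: idm_unit_inj; rewrite -qtraceE loop_sum scaler_suml.
by apply: eq_bigr => i _; rewrite qtraceE.
Qed.

Lemma monodromy_traceC X Y : monodromy_trace X Y = monodromy_trace Y X.
Proof. exact: qtrace_cyclic. Qed.

(** With nested duals the closed strand of [Y] encircles [X] inside the loop of [X]; the scalar
    comes out and the loop of [X] remains. *)
Lemma monodromy_trace_encl X Y a : (forall T, encl X Y T = a *: idm (X \ox T)) ->
  monodromy_trace X Y = a * qdim X.
Proof.
move=> aE; apply: idm_unit_inj.
rewrite /monodromy_trace /qdim
  -(qtrace_loop (strict_dual_tens (std_dual X) (std_dual Y))).
rewrite -scalerA -qtraceE loop_monodromy aE loop_std act1 comp1m compZl comp1m.
by rewrite compZr.
Qed.

Lemma encl_tens_scalar X Y Z a b :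
  (forall T, encl X Y T = a *: idm (X \ox T)) ->
  (forall T, encl X Z T = b *: idm (X \ox T)) ->
  forall T, encl X (Y \ox Z) T = (a * b) *: idm (X \ox T).
Proof.
move=> aE bE T; rewrite encl_tens bE /whisk tensmZr tensm1 compZl comp1m.
by rewrite !compZr mulrC -scalerA -aE enclE.
Qed.

(** Nested circles multiply their scalars; the factors [qdim X] convert scalars into traces. *)
Lemma monodromy_trace_tens X Y Z : scalar_end X ->
  monodromy_trace X (Y \ox Z) * qdim X = monodromy_trace X Y * monodromy_trace X Z.
Proof.
move=> hX; have [a aE] := encl_scalar Y hX; have [b bE] := encl_scalar Z hX.
rewrite (monodromy_trace_encl aE) (monodromy_trace_encl bE).
rewrite (monodromy_trace_encl (encl_tens_scalar aE bE)).
by rewrite mulrACA mulrA.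
Qed.

Lemma monodromy_trace_qdim0 X Y : scalar_end X -> qdim X = 0 -> monodromy_trace X Y = 0.
Proof. by move=> /(encl_scalar Y)[a /monodromy_trace_encl ->] ->; rewrite mulr0. Qed.

(** The identity of [Y] is inserted as the sum of its projectors; cyclicity and naturality of the
    braiding move each of them onto its summand. *)
Lemma monodromy_trace_direct_sum X Y n (F : 'I_n -> C) : direct_sum F Y ->
  monodromy_trace X Y = \sum_i monodromy_trace X (F i).
Proof.
move=> [inj [proj [pi_id _ sum_id]]].
have -> : monodromy_trace X Y = qtrace ((braid Y X \comp braid X Y)
    \comp (\sum_i whisk X (inj i \comp proj i))).
  by rewrite /whisk -tensm_sumr sum_id tensm1 compm1.
rewrite comp_sumr qtrace_sum; apply: eq_bigr => i _.
rewrite whiskM compmA qtrace_cyclic -compmA braid_whiskr.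
have h : braid Y X \comp act (inj i) X = whisk X (inj i) \comp braid (F i) X.
  exact: braid_natural.
by rewrite (compR22 h) !compmA -whiskM pi_id whisk1 comp1m.
Qed.

End PartialTrace.

(** * Multiplicities *)

Section LinearMaps.
Variable K : fieldType.

Lemma dim_le_injective (U V : vectType K) (phi : U -> V) :
  linear phi -> injective phi -> (\dim {: U} <= \dim {: V})%N.
Proof.
move=> phi_lin phi_inj.
pose phiL := GRing.isLinear.Build K U V _ phi phi_lin.
pose f : {linear U -> V} := HB.pack phi phiL.
have ker0 : (fullv :&: lker (linfun f) = 0)%VS.
  suff /eqP -> : lker (linfun f) == 0%VS by rewrite capv0.
  by apply/lker0P => u v; rewrite !lfunE; apply: phi_inj.
by rewrite -(limg_dim_eq ker0) dimvS ?subvf.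
Qed.

Lemma dim_eq_bijective (U V : vectType K) (phi : U -> V) (psi : V -> U) :
  linear phi -> cancel phi psi -> cancel psi phi -> \dim {: U} = \dim {: V}.
Proof.
move=> phi_lin phiK psiK; apply/eqP; rewrite eqn_leq.
rewrite (dim_le_injective phi_lin (can_inj phiK)).
apply: (dim_le_injective _ (can_inj psiK)) => a u v.
by apply: (can_inj phiK); rewrite phi_lin !psiK.
Qed.

Lemma dim_sum_decomposition (V : vectType K) n (U : 'I_n -> vectType K)
    (inj : forall i, U i -> V) (proj : forall i, V -> U i) :
  (forall i, linear (inj i)) -> (forall i, linear (proj i)) ->
  (forall i, cancel (inj i) (proj i)) ->
  (forall i j u, i != j -> proj i (inj j u) = 0) ->
  (forall v, v = \sum_i inj i (proj i v)) ->
  \dim {: V} = (\sum_i \dim {: U i})%N.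
Proof.
move=> inj_lin proj_lin injK proj0 sumE.
pose f i : {linear U i -> V} :=
  HB.pack (inj i) (GRing.isLinear.Build K (U i) V _ (inj i) (inj_lin i)).
pose g i : {linear V -> U i} :=
  HB.pack (proj i) (GRing.isLinear.Build K V (U i) _ (proj i) (proj_lin i)).
pose W i := (linfun (f i) @: fullv)%VS.
have dimW i : \dim (W i) = \dim {: U i}.
  apply: limg_dim_eq; suff /eqP -> : lker (linfun (f i)) == 0%VS by rewrite capv0.
  by apply/lker0P => u v; rewrite !lfunE; apply: (can_inj (injK i)).
have sumW : (\sum_i W i)%VS = fullv.
  apply/eqP; rewrite eqEsubv subvf; apply/subvP => v _.
  rewrite [v]sumE; apply: memv_sumr => i _.
  by apply/memv_imgP; exists (proj i v); rewrite ?memvf ?lfunE.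
have dirW : directv (\sum_i W i).
  apply/directv_sum_independent => u uW sum0 i _.
  have {}uW j : exists w, u j = inj j w.
    by have /memv_imgP[w _ ->] := uW j isT; exists w; rewrite lfunE.
  have [w uE] := uW i.
  have := congr1 (g i) sum0; rewrite linear0 linear_sum (bigD1 i) //=.
  rewrite big1 => [|j ji]; last by have [x ->] := uW j; rewrite proj0 // eq_sym.
  rewrite addr0 uE injK => ->; exact: (linear0 (f i)).
rewrite -sumW -(eq_bigr _ (fun i _ => dimW i)).
exact: directvP dirW.
Qed.

End LinearMaps.

Import VectorInternalTheory.

Lemma eigenvector_closed (K : numClosedFieldType) (V : vectType K)
    (phi : V -> V) (v0 : V) :
  linear phi -> v0 <> 0 -> exists a v, v <> 0 /\ phi v = a *: v.
Proof.
move=> phi_lin v0_neq0.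
pose f : {linear V -> V} := HB.pack phi (GRing.isLinear.Build K V V _ phi phi_lin).
pose A := lin1_mx (v2r \o f \o r2v).
have n_gt0 : (0 < dim V)%N.
  rewrite lt0n; apply/eqP => d0; apply: v0_neq0; apply: (can_inj v2rK).
  by apply/rowP => -[i i_lt]; exfalso; move: i_lt; rewrite d0.
have [a /eigenvalueP[w wA w_neq0]] := eigenvalue_closed A n_gt0.
exists a, (r2v w); split.
  by move/(congr1 v2r); rewrite r2vK linear0 => /eqP; rewrite (negPf w_neq0).
apply: (can_inj v2rK); rewrite linearZ /= r2vK -wA mul_rV_lin1 /=.
by [].
Qed.

Section Schur.
Variables (K : numClosedFieldType) (C : linCat K).
Hypothesis abC : abelian_cat C.
Implicit Types A B S Z : C.

(** The kernel of [f] is mono into the simple [A], and not invertible because [f] is nonzero. So it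
    vanishes, [f] is mono, and simplicity of [B] concludes. *)
Lemma schur A B (f : hom A B) : simple A -> simple B -> f <> 0 -> is_iso f.
Proof.
have [_ ker _ _ _] := abC => -[idA simA] [_ simB] f_neq0.
have [Z [k [fk0 k_univ]]] := ker _ _ f.
have k_mono : is_mono k.
  move=> S g h gh.
  have [u [_ u_uniq]] : exists! u, k \comp u = k \comp g.
    by apply: k_univ; rewrite compmA fk0 comp0l.
  by rewrite -(u_uniq g) // -(u_uniq h).
have k0 : k = 0.
  case: (simA _ _ k_mono) => // -[k' [_ kk']].
  by case: f_neq0; rewrite -[f]compm1 -kk' compmA fk0 comp0l.
have f_mono : is_mono f.
  move=> S g h gh.
  have [u [ku _]] : exists! u, k \comp u = g - h.
    by apply: k_univ; rewrite compBr gh subrr.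
  by apply/eqP; rewrite -subr_eq0 -ku k0 comp0l.
by case: (simB _ _ f_mono).
Qed.

(** Composition with [f] has an eigenvector [v] in [hom A A]; then [f - a *: idm A] kills [v], is
    not invertible, and is zero by [schur]. *)
Lemma simple_scalar A : simple A -> scalar_end A.
Proof.
move=> simA f; have [idA _] := simA.
have [a [v [v_neq0 fv]]] := eigenvector_closed (compm_linearr f) idA.
exists a; apply: contrapT => f_neq.
have [|g [gf _]] := @schur _ _ (f - a *: idm A) simA simA.
  by move/eqP; rewrite subr_eq0 => /eqP.
apply: v_neq0; rewrite -[v]comp1m -gf -compmA compBl fv compZl comp1m subrr.
exact: comp0r.
Qed.

End Schur.

Section Additivity.
Variables (K : fieldType) (C : linCat K).
Implicit Types A B S Z : C.

Lemma direct_sum_isomorphic n (F F' : 'I_n -> C) S :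
  (forall i, isomorphic (F' i) (F i)) -> direct_sum F S -> direct_sum F' S.
Proof.
move=> isoF [inj [proj [pi_id pi_0 sum_id]]].
pose f i : hom (F' i) (F i) := sval (cid (isoF i)).
pose g i : hom (F i) (F' i) := sval (cid (svalP (cid (isoF i)))).
have gK i : inverses (f i) (g i) := svalP (cid (svalP (cid (isoF i)))).
exists (fun i => inj i \comp f i), (fun i => g i \comp proj i); split=> [i|i j ij|].
- by have [gf _] := gK i; rewrite -compmA (compR21 (pi_id i)) comp1m.
- by rewrite -compmA (compR21 (pi_0 _ _ ij)) comp0l comp0r.
- rewrite -sum_id; apply: eq_bigr => i _; have [_ fg] := gK i.
  by rewrite -compmA (compR21 fg) comp1m.
Qed.

Lemma dim_hom_direct_sumr Z n (F : 'I_n -> C) S : direct_sum F S ->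
  \dim {: hom Z S} = (\sum_i \dim {: hom Z (F i)})%N.
Proof.
move=> [inj [proj [pi_id pi_0 sum_id]]].
apply: (dim_sum_decomposition (U := fun i => hom Z (F i))
  (inj := fun i f => inj i \comp f) (proj := fun i f => proj i \comp f)) => //.
- by move=> i; apply: compm_linearr.
- by move=> i; apply: compm_linearr.
- by move=> i f; rewrite compmA pi_id comp1m.
- by move=> i j f ij; rewrite compmA pi_0 // comp0l.
- move=> f; rewrite -[LHS]comp1m -sum_id comp_suml.
  by apply: eq_bigr => i _; rewrite compmA.
Qed.

Lemma dim_hom_direct_suml Z n (F : 'I_n -> C) S : direct_sum F S ->
  \dim {: hom S Z} = (\sum_i \dim {: hom (F i) Z})%N.
Proof.
move=> [inj [proj [pi_id pi_0 sum_id]]].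
apply: (dim_sum_decomposition (U := fun i => hom (F i) Z)
  (inj := fun i f => f \comp proj i) (proj := fun i f => f \comp inj i)) => //.
- by move=> i; apply: compm_linearl.
- by move=> i; apply: compm_linearl.
- by move=> i f; rewrite -compmA pi_id compm1.
- by move=> i j f ij; rewrite -compmA pi_0 1?eq_sym // comp0r.
- move=> f; rewrite -[LHS]compm1 -sum_id comp_sumr.
  by apply: eq_bigr => i _; rewrite -compmA.
Qed.

Definition additive_on_sums (V : nmodType) (s : C -> V) :=
  forall n (F : 'I_n -> C) S, direct_sum F S -> s S = \sum_i s (F i).

Lemma additive_isomorphic (V : nmodType) (s : C -> V) A B :
  additive_on_sums s -> isomorphic A B -> s B = s A.
Proof.
by move=> s_add /isomorphic_direct_sum /s_add ->; rewrite big_ord1.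
Qed.

End Additivity.

Section MonoidalSums.
Variables (K : fieldType) (C : monCat K).
Implicit Types A B S Z : C.

Lemma direct_sum_tensl Z n (F : 'I_n -> C) S :
  direct_sum F S -> direct_sum (fun i => F i \ox Z) (S \ox Z).
Proof.
move=> [inj [proj [pi_id pi_0 sum_id]]].
exists (fun i => act (inj i) Z), (fun i => act (proj i) Z); split=> [i|i j ij|].
- by rewrite -actM pi_id act1.
- by rewrite -actM pi_0 // /act tensm0l.
- under eq_bigr do rewrite -actM /act.
  by rewrite -tensm_suml sum_id tensm1.
Qed.

Lemma direct_sum_tensr Z n (F : 'I_n -> C) S :
  direct_sum F S -> direct_sum (fun i => Z \ox F i) (Z \ox S).
Proof.
move=> [inj [proj [pi_id pi_0 sum_id]]].
exists (fun i => whisk Z (inj i)), (fun i => whisk Z (proj i)); split=> [i|i j ij|].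
- by rewrite -whiskM pi_id whisk1.
- by rewrite -whiskM pi_0 // /whisk tensm0r.
- under eq_bigr do rewrite -whiskM /whisk.
  by rewrite -tensm_sumr sum_id tensm1.
Qed.

(** Tensoring with [A'] is left adjoint to tensoring with [A]; the two zigzag identities are the two
    inverse laws. *)
Lemma dim_hom_dual (A A' S T : C) ev coev : @is_duality K C A A' ev coev ->
  \dim {: hom S (A \ox T)} = \dim {: hom (A' \ox S) T}.
Proof.
move=> dualA.
apply: (dim_eq_bijective (phi := fun f => evT ev T \comp whisk A' f)
    (psi := fun g => whisk A g \comp coT coev S)).
- by move=> a f g; rewrite /whisk tensm_linearr compm_linearr.
- move=> f; rewrite whiskM -compmA coT_natural compmA (zigzag1 dualA).
  by rewrite comp1m.
- move=> g; rewrite whiskM compmA evT_natural -compmA (zigzag2 dualA).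
  by rewrite compm1.
Qed.

End MonoidalSums.

Section Multiplicities.
Variables (K : numClosedFieldType) (C : fusionCat K) (m : nat) (X : 'I_m -> C).
Hypothesis reps : simple_reps X.
Implicit Types A B S Y Z : C.

Lemma simple_decomposition Y :
  exists n (sigma : 'I_n -> 'I_m), direct_sum (fun i => X (sigma i)) Y.
Proof.
have [n [F [simF sumF]]] := fusion_semisimple Y; have [_ _ repX] := reps.
pose sigma i := sval (cid (repX _ (simF i))).
have isoF i : isomorphic (X (sigma i)) (F i).
  exact: isomorphic_sym (svalP (cid (repX _ (simF i)))).
by exists n, sigma; apply: direct_sum_isomorphic sumF.
Qed.

Lemma dim_hom_simple k l : \dim {: hom (X k) (X l)} = (k == l) :> nat.
Proof.
have [simX isoX _] := reps; case: eqP => [->|kl].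
  have [idX _] := simX l.
  have -> : fullv = <[idm (X l)]>%VS.
    apply/eqP; rewrite eq_sym eqEsubv subvf; apply/subvP => f _.
    have [a ->] := simple_scalar (fusion_abelian C) (simX l) f.
    by rewrite memvZ // memv_line.
  by rewrite dim_vline; case: eqP idX.
apply/eqP; rewrite dimv_eq0 -subv0; apply/subvP => f _; rewrite memv0.
apply/eqP; apply: contrapT => f_neq0; apply: kl; apply: isoX; exists f.
exact: (schur (fusion_abelian C) (simX k) (simX l) f_neq0).
Qed.

Lemma multiplicity_additive k : additive_on_sums (multiplicity X k).
Proof. by move=> n F S; apply: dim_hom_direct_sumr. Qed.

(** By semisimplicity an additive invariant is determined by its values on simple objects. It is
    applied to dimensions of hom spaces, to multiplicities in tensor products and to traces. *)
Lemma additive_simples (V : nmodType) (s : C -> V) Y :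
  additive_on_sums s -> s Y = \sum_k s (X k) *+ multiplicity X k Y.
Proof.
move=> s_add; have [n [sigma sumY]] := simple_decomposition Y.
rewrite (s_add _ _ _ sumY).
under [RHS]eq_bigr => k _ do rewrite (multiplicity_additive k sumY) -sumrMnr.
rewrite exchange_big /=; apply: eq_bigr => i _.
rewrite (bigD1 (sigma i)) //= /multiplicity dim_hom_simple eqxx mulr1n.
by rewrite big1 ?addr0 // => k /negPf ki; rewrite dim_hom_simple ki mulr0n.
Qed.

Lemma dim_hom_to_simple k Y : \dim {: hom Y (X k)} = multiplicity X k Y.
Proof.
have -> := additive_simples (s := fun Z => \dim {: hom Z (X k)}) Y.
  rewrite (bigD1 k) //= dim_hom_simple eqxx big1 => [|l /negPf lk].
    by rewrite addr0 natn.
  by rewrite dim_hom_simple lk mul0rn.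
by move=> n F S; apply: dim_hom_direct_suml.
Qed.

Lemma multiplicity_isomorphic k A B :
  isomorphic A B -> multiplicity X k B = multiplicity X k A.
Proof. exact: additive_isomorphic (multiplicity_additive k). Qed.

Lemma multiplicity_tens k Y Z : multiplicity X k (Y \ox Z)
  = (\sum_i \sum_j multiplicity X i Y * multiplicity X j Z
       * multiplicity X k (X i \ox X j))%N.
Proof.
rewrite (additive_simples (s := fun Y => multiplicity X k (Y \ox Z)) Y); last first.
  by move=> n F S /(direct_sum_tensl Z) /multiplicity_additive.
apply: eq_bigr => i _.
rewrite (additive_simples (s := fun Z => multiplicity X k (X i \ox Z)) Z); last first.
  by move=> n F S /(direct_sum_tensr (X i)) /multiplicity_additive.
rewrite -sumrMnl; apply: eq_bigr => j _.
by rewrite -mulrnA -[LHS]mulr_natl natn [X in X * _ = _]mulnC.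
Qed.

(** Frobenius reciprocity: the adjunction [dim_hom_dual], after exchanging source and target by
    [dim_hom_to_simple]. *)
Lemma multiplicity_dual k l A :
  multiplicity X l (dual A \ox X k) = multiplicity X k (A \ox X l).
Proof. by rewrite -dim_hom_to_simple -(dim_hom_dual _ _ (dualP A)). Qed.

Lemma isomorphic_lunit Y : isomorphic (unitob C \ox Y) Y.
Proof. by exists (lunit Y), (lunitV Y); apply: lunitK. Qed.

Lemma isomorphic_runit Y : isomorphic (Y \ox unitob C) Y.
Proof. by exists (runit Y), (runitV Y); apply: runitK. Qed.

Lemma support_direct_sum k n (F : 'I_n -> C) S : direct_sum F S ->
  (multiplicity X k S != 0)%N <-> exists i, (multiplicity X k (F i) != 0)%N.
Proof.
move=> /multiplicity_additive ->; split=> [h|[i hi]].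
  apply: contrapT => h'; case/eqP: h.
  apply: big1 => i _; apply/eqP; apply: contrapT => /negP hi.
  by apply: h'; exists i.
by rewrite (bigD1 i) //= addn_eq0 negb_and hi.
Qed.

Lemma subcat_support (D : C -> Prop) Y k :
  fusion_subcat D -> D Y -> (multiplicity X k Y != 0)%N -> D (X k).
Proof.
move=> [_ _ _ Dsum] DY; have [n [sigma sumY]] := simple_decomposition Y.
move/(support_direct_sum k sumY) => [j]; rewrite /multiplicity dim_hom_simple.
case: (k =P sigma j) => [-> _|//]; exact: (iffLR (Dsum _ _ _ sumY)).
Qed.

Lemma gr_class_tens (A : comPzRingType) Y Z :
  gr_class X A (Y \ox Z) = gr_mul X (gr_class X A Y) (gr_class X A Z).
Proof.
apply/rowP => k; rewrite /gr_mul summxE mxE multiplicity_tens natr_sum.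
apply: eq_bigr => i _; rewrite summxE natr_sum; apply: eq_bigr => j _.
by rewrite !mxE !natrM.
Qed.

End Multiplicities.

(** * Characters of a commutative based ring *)

Section FusionRing.
Variables (C : numClosedFieldType) (n : nat).
Local Notation I := 'I_n.+1.
Variables (N : I -> I -> I -> nat) (star : I -> I) (mu : I -> I -> C).
Implicit Types (i j k l p q : I) (a : I -> C).

Definition character a :=
  a ord0 = 1 /\ forall i k, a i * a k = \sum_l (N i k l)%:R * a l.

Hypotheses (N0 : forall j k, N ord0 j k = (j == k) :> nat)
  (NC : forall i j k, N i j k = N j i k)
  (Nstar : forall i j k, N (star i) k j = N i j k)
  (muP : forall j, character (mu j))
  (mu_unit : \matrix_(j, i) mu j i \in unitmx).

Let mu0 j : mu j ord0 = 1. Proof. by case: (muP j). Qed.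
Let muM j i k : mu j i * mu j k = \sum_l (N i k l)%:R * mu j l.
Proof. by case: (muP j). Qed.

Lemma fusion_to_unit i j : N i j ord0 = (star i == j) :> nat.
Proof. by rewrite -Nstar NC N0. Qed.

Lemma starK : involutive star.
Proof.
move=> i; apply/eqP; have := fusion_to_unit (star i) i.
by rewrite NC fusion_to_unit eqxx; case: eqP.
Qed.

Let norm2 j : C := \sum_l mu j l * (mu j l)^*.

Lemma norm2_gt0 j : 0 < norm2 j.
Proof.
rewrite /norm2 (bigD1 ord0) //= mu0 rmorph1 mulr1 ltr_pwDl ?ltr01 //.
by apply: sumr_ge0 => l _; apply: mul_conjC_ge0.
Qed.

(** By [Nstar], multiplications by [i] and by [star i] are adjoint to each other; the vectors [mu j]
    and [mu k] are eigenvectors of them. *)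
Lemma character_pairing j k i :
  mu j i * (\sum_l mu j l * (mu k l)^*)
    = (mu k (star i))^* * \sum_l mu j l * (mu k l)^*.
Proof.
rewrite !mulr_sumr.
under eq_bigr do rewrite mulrA muM mulr_suml.
under [RHS]eq_bigr do rewrite mulrCA -rmorphM /= muM rmorph_sum mulr_sumr.
rewrite exchange_big /=; apply: eq_bigr => p _; apply: eq_bigr => l _.
rewrite rmorphM /= conjC_nat Nstar. by rewrite -mulrA [RHS]mulrCA.
Qed.

(** The pairing of [mu j] with itself is positive, so it cancels in [character_pairing]. *)
Lemma character_star j i : mu j (star i) = (mu j i)^*.
Proof.
have := mulIf (lt0r_neq0 (norm2_gt0 j)) (character_pairing j j i).
move/(congr1 (fun x => x^*)).
by rewrite conjCK.
Qed.

(** A nonzero pairing would cancel in [character_pairing] and make [mu j] and [mu k] equal rows of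
    an invertible matrix. *)
Lemma character_orthogonal j k : j != k -> \sum_l mu j l * (mu k l)^* = 0.
Proof.
move=> jk; apply/eqP; apply: contraT => h; case/eqP: jk.
have e i : mu j i = mu k i.
  by have := mulIf h (character_pairing j k i); rewrite character_star conjCK.
pose U := \matrix_(j, i) mu j i; have Ui : row_free U by rewrite row_free_unit.
suff : delta_mx 0 j *m U = delta_mx 0 k *m U :> 'rV_ _.
  move/(row_free_inj Ui)/rowP/(_ j); rewrite !mxE !eqxx /=.
  by case: eqP => // _ /eqP; rewrite oner_eq0.
by rewrite -!rowE; apply/rowP => i; rewrite !mxE.
Qed.

Lemma character_eq a : character a -> exists j, a =1 mu j.
Proof.
move=> [a0 aM]; pose U := \matrix_(j, i) mu j i.
(* The columns of the inverse character matrix hold the coordinates of the primitive idempotents: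
   [mu k] is 1 on [e j] if [k = j] and 0 otherwise. *)
pose e j : 'cV_n.+1 := invmx U *m delta_mx j 0.
have eE j k : \sum_i e j i 0 * mu k i = (k == j)%:R.
  have := congr1 (fun M : 'cV_n.+1 => M k 0) (mulKVmx mu_unit (delta_mx j 0 : 'cV_n.+1)).
  rewrite !mxE eqxx andbT => <-; apply: eq_bigr => i _.
  by rewrite !mxE mulrC.
have mu_inj (u v : I -> C) :
    (forall k, \sum_i u i * mu k i = \sum_i v i * mu k i) -> u =1 v.
  move=> uv i; have : U *m (\col_i u i) = U *m (\col_i v i).
    apply/colP => k; rewrite !mxE.
    under eq_bigr do rewrite !mxE mulrC.
    by rewrite uv; apply: eq_bigr => l _; rewrite !mxE mulrC.
  move/(congr1 (mulmx (invmx U))); rewrite !mulKmx //.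
  by move/colP/(_ i); rewrite !mxE.
(* Multiplying the idempotent [e j] by the basis element [i] scales it by [mu j i], as is tested on
   all [mu k]; the character [a] is then applied to this relation. *)
have a_e j i : (\sum_k e j k 0 * a k) * a i = (\sum_k e j k 0 * a k) * mu j i.
  have : (fun l => \sum_k e j k 0 * (N k i l)%:R) =1 (fun l => e j l 0 * mu j i).
    apply: mu_inj => k.
    under [RHS]eq_bigr do rewrite mulrAC.
    rewrite -mulr_suml eE.
    transitivity ((\sum_l e j l 0 * mu k l) * mu k i).
      rewrite mulr_suml.
      under [RHS]eq_bigr do rewrite -mulrA muM mulr_sumr.
      rewrite exchange_big /=; apply: eq_bigr => l _.
      by rewrite mulr_suml; apply: eq_bigr => p _; rewrite mulrA.
    by rewrite eE; case: (k =P j) => [->|]; rewrite ?mul1r ?mul0r.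
  move=> h; rewrite !mulr_suml.
  under eq_bigr do rewrite -mulrA aM mulr_sumr.
  rewrite exchange_big /=; apply: eq_bigr => l _.
  by rewrite mulrAC -h mulr_suml; apply: eq_bigr => p _; rewrite mulrA.
have [j aj|a_e0] := pickP (fun j => \sum_k e j k 0 * a k != 0).
  by exists j => i; apply: (mulfI aj).
(* The idempotents sum to the unit, so [a] cannot vanish on all of them. *)
case/negP: (oner_neq0 C); rewrite -a0.
have -> : a ord0 = \sum_j mu j ord0 * \sum_k e j k 0 * a k.
  under eq_bigr do rewrite mu0 mul1r.
  rewrite exchange_big /=.
  under eq_bigr do rewrite -mulr_suml.
  have e1 : (fun i => \sum_j e j i 0) =1 (fun i => (i == ord0)%:R).
    apply: mu_inj => k.
    under eq_bigr do rewrite mulr_suml.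
    rewrite exchange_big /=.
    under eq_bigr do rewrite eE.
    rewrite (bigD1 k) //= ?eqxx big1 => [|j /negPf kj]; last by rewrite eq_sym kj.
    rewrite addr0 (bigD1 ord0) //= ?eqxx mul1r mu0 big1 ?addr0 // => i /negPf ->.
    by rewrite mul0r.
  under eq_bigr do rewrite e1.
  by rewrite (bigD1 ord0) //= ?eqxx mul1r big1 ?addr0 // => i /negPf ->; rewrite mul0r.
by rewrite big1 // => j _; have /negbFE/eqP -> := a_e0 j; rewrite mulr0.
Qed.

(** * Existence of a positive character *)

Section Perron.
Hypothesis mu00 : forall i, mu ord0 i != 0.

Let z j : C := \sum_i mu j i.
(** The matrix of multiplication by the sum of all basis elements; [z] lists its eigenvalues, one
    for each character. *)
Let M k l : C := \sum_i (N i k l)%:R.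

(** A zero entry would make the product of [star k] and [l] zero, but [mu ord0] does not vanish on
    it. *)
Let M_gt0 k l : 0 < M k l.
Proof.
rewrite lt0r sumr_ge0 ?andbT => [|i _]; last exact: ler0n.
apply/eqP => M0; have /negP := mulf_neq0 (mu00 (star k)) (mu00 l); apply.
have {}M0 i : (N i k l)%:R = 0 :> C.
  by apply: (psumr_eq0P _ M0) => // p _; apply: ler0n.
by rewrite muM big1 // => i _; rewrite Nstar NC M0 mul0r.
Qed.

Let M_mu j k : \sum_l M k l * mu j l = z j * mu j k.
Proof.
rewrite /z mulr_suml.
under [RHS]eq_bigr do rewrite muM.
by rewrite exchange_big /=; apply: eq_bigr => l _; rewrite mulr_suml.
Qed.

Let z_real j : z j \is Num.real.
Proof.
apply/CrealP; rewrite /z rmorph_sum /= (reindex_inj (inv_inj starK)) /=.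
by apply: eq_bigr => i _; rewrite character_star conjCK.
Qed.

(* Among the characters, one maximizing [z] has a vector of absolute values that
   maximizes the Rayleigh quotient of [M]; the triangle inequality is then an
   equality, which forces all the values to be nonnegative. *)
Lemma positive_character : exists j, forall i, 0 < mu j i.
Proof.
have [j _ z_max] := real_arg_maxP (P := xpredT) (i0 := ord0) isT (fun i _ => z_real i).
exists j; pose w l : C := `|mu j l|.
pose U := \matrix_(j, i) mu j i.
(* The coordinates of [w] in the orthogonal basis of eigenvectors [mu p]. *)
pose c := (\row_l w l) *m invmx U.
have wE l : w l = \sum_p c 0 p * mu p l.
  have := congr1 (fun v : 'rV_n.+1 => v 0 l) (mulmxKV mu_unit (\row_l w l)).
  rewrite -/c mxE [X in _ = X]mxE => <-.
  by apply: eq_bigr => p _; congr (_ * _); rewrite mxE.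
have w_conj l : (w l)^* = w l by rewrite /w conj_normC.
have parseval b : \sum_k w k * \sum_p b p * mu p k
    = \sum_p b p * (c 0 p)^* * norm2 p.
  under eq_bigr do rewrite mulr_sumr.
  rewrite exchange_big /=; apply: eq_bigr => p _.
  under eq_bigr do rewrite mulrCA.
  rewrite -mulr_sumr -mulrA; congr (_ * _).
  under eq_bigr do rewrite -w_conj wE rmorph_sum mulr_suml.
  rewrite exchange_big (bigD1 p) //= [X in _ + X]big1 => [|q qp].
    rewrite addr0 mulr_sumr; apply: eq_bigr => k _.
    by rewrite rmorphM /= -mulrA [mu p k * _]mulrC.
  under eq_bigr do rewrite rmorphM /= -mulrA [_ * mu p _]mulrC.
  by rewrite -mulr_sumr character_orthogonal 1?eq_sym // mulr0.
pose F (kl : I * I) := (mu j kl.1)^* * (M kl.1 kl.2 * mu j kl.2).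
have normF kl : `|F kl| = w kl.1 * (M kl.1 kl.2 * w kl.2).
  by rewrite !normrM norm_conjC (gtr0_norm (M_gt0 _ _)).
have sumF : \sum_kl F kl = z j * norm2 j.
  rewrite -(pair_bigA _ (fun k l => F (k, l))) /=.
  rewrite mulr_sumr; apply: eq_bigr => k _.
  by rewrite /F /= -mulr_sumr M_mu mulrC -mulrA.
have Mw k : \sum_l M k l * w l = \sum_p (c 0 p * z p) * mu p k.
  under eq_bigr do rewrite wE mulr_sumr.
  rewrite exchange_big /=; apply: eq_bigr => p _.
  under eq_bigr do rewrite mulrCA.
  by rewrite -mulr_sumr M_mu mulrA.
have norm2_w : norm2 j = \sum_p c 0 p * (c 0 p)^* * norm2 p.
  rewrite -parseval; apply: eq_bigr => k _.
  by rewrite -wE -normCK expr2.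
(* The Rayleigh bound: in the eigenbasis each [z p] is at most the maximal eigenvalue [z j]. *)
have sum_normF : \sum_kl `|F kl| <= z j * norm2 j.
  rewrite -(pair_bigA _ (fun k l => `|F (k, l)|)) /=.
  under eq_bigr => k _ do (under eq_bigr do rewrite normF /=; rewrite -mulr_sumr Mw).
  rewrite parseval norm2_w mulr_sumr; apply: ler_sum => p _.
  rewrite [X in X * _ <= _]mulrAC [z j * _]mulrC [X in X <= _]mulrAC.
  apply: ler_wpM2l; last exact: z_max.
  by rewrite mulr_ge0 ?mul_conjC_ge0 // ltW ?norm2_gt0.
have eqF : \sum_kl F kl = \sum_kl `|F kl|.
  have normFE : `|\sum_kl F kl| = \sum_kl `|F kl|.
    apply/eqP; rewrite eq_le ler_norm_sum (le_trans sum_normF) // -sumF.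
    by apply: real_ler_norm; rewrite sumF rpredM ?z_real // gtr0_real ?norm2_gt0.
  apply/eqP; rewrite eq_le sumF sum_normF andbT -normFE sumF.
  by rewrite real_ler_norm // rpredM ?z_real // gtr0_real ?norm2_gt0.
have F_ge0 kl : 0 <= F kl.
  have -> : F kl = `|F kl|.
    by apply: (normC_sum_upper (G := fun kl => `|F kl|) _ eqF) => // p _; apply: lexx.
  exact: normr_ge0.
(* The row of [ord0] suffices, since [mu j] is 1 there and the entries of [M] are positive. *)
have mu_ge0 l : 0 <= mu j l.
  have := F_ge0 (ord0, l); rewrite /F /= mu0 rmorph1 mul1r.
  by rewrite pmulr_rge0.
move=> k; rewrite lt0r mu_ge0 andbT; apply/eqP => muk0.
(* A zero at [k] would annihilate row [k] of [M] applied to [mu j], whose [ord0] term is positive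
   and whose other terms are nonnegative. *)
have := M_mu j k; rewrite muk0 mulr0 (bigD1 ord0) //= mu0 mulr1 => /eqP.
apply/negP; rewrite gt_eqF // ltr_pwDl // sumr_ge0 // => l _.
by rewrite mulr_ge0 // ltW.
Qed.

End Perron.

Section PositiveCharacter.
Variable j0 : I.
Let d := mu j0.
Hypothesis d_gt0 : forall i, 0 < d i.

Lemma positive_character_star i : d (star i) = d i.
Proof. by rewrite /d character_star conj_Creal // gtr0_real. Qed.

Lemma sum_positive_character i k :
  \sum_l (N i l k)%:R * d l = d i * d k.
Proof.
rewrite -(positive_character_star i) [RHS](muM j0).
by apply: eq_bigr => l _; rewrite Nstar.
Qed.

(** The eigenvector equation is summed in absolute value against the weights [d k]. As [d] is a
    character, the nonnegative multiplication matrix turns these weights into [d i] times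
    themselves. *)
Lemma eigenvalue_le_positive_character (v : I -> C) b i :
  (forall k, \sum_l v l * (N i l k)%:R = b * v k) -> (exists l, v l != 0) ->
  `|b| <= d i.
Proof.
move=> vE [l0 vl0].
have nv_gt0 : 0 < \sum_l `|v l| * d l.
  rewrite (bigD1 l0) //= ltr_pwDl ?mulr_gt0 ?normr_gt0 //.
  by apply: sumr_ge0 => l _; rewrite mulr_ge0 // ltW.
rewrite -(ler_pM2r nv_gt0) mulr_sumr.
have -> : d i * \sum_l `|v l| * d l = \sum_k (\sum_l `|v l| * (N i l k)%:R) * d k.
  under [RHS]eq_bigr do rewrite mulr_suml.
  rewrite exchange_big mulr_sumr; apply: eq_bigr => l _ /=.
  rewrite mulrCA (muM j0) mulr_sumr; apply: eq_bigr => k _.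
  by rewrite mulrA.
apply: ler_sum => k _; rewrite mulrA ler_pM2r // -normrM -vE.
apply: le_trans (ler_norm_sum _ _ _) _; apply: ler_sum => l _.
by rewrite normrM normr_nat.
Qed.

End PositiveCharacter.

(** * Characters at invertible and noninvertible indices *)

Section Burnside.
Variable delta : I -> C.
Hypotheses (delta_neq0 : forall j, delta j != 0)
  (delta_mu : forall i j, delta i * mu i j = delta j * mu j i).

Definition invertible j := forall k, N j (star j) k = (k == ord0) :> nat.

Hypothesis burnside_mu :
  forall j, (exists a, character a /\ a j = 0) <-> ~ invertible j.

Lemma mu_ord0_neq0 i : mu ord0 i != 0.
Proof.
have := delta_mu ord0 i; rewrite mu0 mulr1 => e.
by apply/eqP => h; move: (delta_neq0 i); rewrite -e h mulr0 eqxx.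
Qed.

Lemma vanishes_noninvertible j : ~ invertible j -> exists i, mu j i = 0.
Proof.
move=> /burnside_mu[a [/character_eq[i aE] aj]]; exists i.
by apply: (mulfI (delta_neq0 j)); rewrite -delta_mu -aE aj !mulr0.
Qed.

(** The product of [j] and [star j] is the unit, and [mu p] takes conjugate values on the two. *)
Lemma normr_invertible p j : invertible j -> `|mu p j| = 1.
Proof.
move=> invj; apply/eqP; rewrite -[_ == 1](@pexpr_eq1 _ _ 2) //.
rewrite normCK -character_star muM (bigD1 ord0) //= invj eqxx mul1r mu0.
rewrite big1 ?addr0 // => k /negPf k0; by rewrite invj k0 mul0r.
Qed.

(** In the symmetry [delta_mu] the factor [mu p j] has modulus 1; the case of [ord0] shows that
    [delta j] and [delta ord0] have the same modulus. *)
Lemma normr_delta_invertible j p : invertible j -> `|delta p| = `|delta ord0| * `|mu j p|.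
Proof.
move=> invj; have e q : `|delta q| = `|delta j| * `|mu j q|.
  by rewrite -normrM -delta_mu normrM normr_invertible // mulr1.
by rewrite e; congr (_ * _); have := e ord0; rewrite mu0 normr1 mulr1.
Qed.

Variable j0 : I.
Let d := mu j0.
Hypothesis d_gt0 : forall i, 0 < d i.

(** As [d] has no zero, [j0] is itself invertible; [normr_delta_invertible] then gives the same
    moduli for [j] and for [j0]. *)
Lemma normr_mu_invertible j p : invertible j -> `|mu j p| = d p.
Proof.
move=> invj; have inv0 : invertible j0.
  apply: contrapT => /vanishes_noninvertible[q dq0].
  by have := d_gt0 q; rewrite /d dq0 ltxx.
apply: (mulfI (_ : `|delta ord0| != 0)); first by rewrite normr_eq0.
rewrite -(normr_delta_invertible p invj) (normr_delta_invertible p inv0).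
by congr (_ * _); apply: gtr0_norm; apply: d_gt0.
Qed.

Section Grading.
Variable j : I.
Hypothesis invj : invertible j.
Let xi i := mu j i / d i.

Lemma normr_grading i : `|xi i| = 1.
Proof.
rewrite /xi normrM normfV normr_mu_invertible // gtr0_norm // divff //.
by rewrite lt0r_neq0.
Qed.

Let mu_xi i : mu j i = d i * xi i.
Proof. by rewrite /xi mulrCA divff ?mulr1 // lt0r_neq0. Qed.

(* [mu j] and [d] are both characters, so the triangle inequality applied to the
   expansion of [x_i * x_k] is an equality. *)
Lemma gradingM i k l : (N i k l != 0)%N -> xi l = xi i * xi k.
Proof.
move=> N_neq0.
have norm_c : `|xi i * xi k| = 1 by rewrite normrM !normr_grading mulr1.
pose F l := (N i k l)%:R * d l * (xi l * (xi i * xi k)^*).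
pose G l := (N i k l)%:R * d l.
have FG : F l = G l.
  apply: (normC_sum_upper (P := xpredT)) => // [p _|].
    rewrite /F /G normrM [X in _ * X]normrM norm_conjC norm_c normr_grading !mulr1.
    by rewrite ger0_norm // mulr_ge0 // ltW.
  transitivity ((mu j i * mu j k) * (xi i * xi k)^*).
    rewrite muM mulr_suml; apply: eq_bigr => p _.
    by rewrite /F mulrA -[_ * d p * _]mulrA -mu_xi.
  rewrite !mu_xi [_ * (d k * _)]mulrACA -[X in X = _]mulrA -normCK norm_c expr1n mulr1.
  exact: (muM j0).
have : xi l * (xi i * xi k)^* = 1.
  have G_neq0 : G l != 0 by rewrite /G mulf_neq0 ?pnatr_eq0 // lt0r_neq0.
  by apply: (mulfI G_neq0); rewrite mulr1; exact: FG.
move/(congr1 (fun x => x * (xi i * xi k))).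
by rewrite mul1r -mulrA [_^* * _]mulrC -normCK norm_c expr1n mulr1.
Qed.

Lemma grading0 : xi ord0 = 1.
Proof. by rewrite /xi /d !mu0 divr1. Qed.

Lemma grading_star i : xi i * xi (star i) = 1.
Proof.
rewrite -(gradingM (l := ord0)) ?grading0 //.
by rewrite fusion_to_unit eqxx.
Qed.

Lemma prod_grading : (\prod_i xi i) ^+ 2 = 1.
Proof.
rewrite expr2 {2}(reindex_inj (inv_inj starK)) -big_split /=.
by rewrite big1 // => i _; apply: grading_star.
Qed.

End Grading.

(** Models the simple objects of the adjoint subcategory; [ad_min] expresses minimality among the
    sets of indices with the same closure properties. *)
Variable ad : pred I.
Hypotheses (ad0 : ad ord0) (adM : forall i k l, ad i -> ad k -> (N i k l != 0)%N -> ad l)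
  (ad_star : forall i, ad i -> ad (star i))
  (ad_self : forall i k, (N i (star i) k != 0)%N -> ad k)
  (ad_min : forall Q : pred I, Q ord0 ->
    (forall i k l, Q i -> Q k -> (N i k l != 0)%N -> Q l) ->
    (forall i, Q i -> Q (star i)) ->
    (forall i k, (N i (star i) k != 0)%N -> Q k) -> forall i, ad i -> Q i).

Lemma mu_ad_invertible j i : invertible j -> ad i -> mu j i = d i.
Proof.
move=> invj adi; suff /eqP e : mu j i / d i == 1.
  by rewrite -[LHS](divfK (lt0r_neq0 (d_gt0 i))) e mul1r.
apply: (ad_min (Q := fun i => mu j i / d i == 1)) adi.
- by rewrite (grading0 j).
- by move=> p k l /eqP p1 /eqP k1 /(gradingM invj) ->; rewrite p1 k1 mulr1.
- by move=> p /eqP p1; have := grading_star invj p; rewrite p1 mul1r => ->.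
- by move=> p k /(gradingM invj) ->; rewrite (grading_star invj).
Qed.

Let regular j := \sum_(i | ad i) d i * mu j i.

(** The sum of the [d i] times the basis elements over [ad] is a regular element of the adjoint
    part: multiplication by [i] in [ad] scales it by [d i]. The lemma is the image of this under
    [mu j]. *)
Lemma mu_regular j i : ad i -> mu j i * regular j = d i * regular j.
Proof.
move=> adi.
(* Closure of [ad] lets the sum run over all [k] when [l] is in [ad], and leaves no nonzero term
   otherwise. *)
have inner l :
    \sum_(k | ad k) d k * (N i k l)%:R = if ad l then d i * d l else 0.
  case: ifP => [adl|/negP nadl]; last first.
    apply: big1 => k adk; have [->|h] := eqVneq (N i k l) 0%N; first by rewrite mulr0.
    by case: nadl; apply: adM h.
  rewrite -[RHS](sum_positive_character d_gt0) big_mkcond; apply: eq_bigr => k _.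
  case: ifP => [_|/negP nadk]; first by rewrite mulrC.
  have [->|h] := eqVneq (N i k l) 0%N; first by rewrite mul0r.
  by case: nadk; apply: (adM (ad_star adi) adl); rewrite Nstar.
rewrite /regular !mulr_sumr.
under eq_bigr do rewrite mulrCA muM mulr_sumr.
rewrite exchange_big [RHS]big_mkcond; apply: eq_bigr => l _ /=.
under eq_bigr do rewrite mulrA.
by rewrite -mulr_suml inner; case: ifP => _; rewrite ?mul0r ?mulrA.
Qed.

Lemma regular_noninvertible j : ~ invertible j -> regular j = 0.
Proof.
move=> /vanishes_noninvertible[i mu_i0]; apply/eqP; apply: contraT => reg_neq0.
have mu_ad k : ad k -> mu j k = d k.
  by move=> adk; apply: (mulIf reg_neq0); exact: mu_regular.
have : mu j i * mu j (star i) = d i * d (star i).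
  rewrite muM [RHS](muM j0); apply: eq_bigr => k _.
  have [->|h] := eqVneq (N i (star i) k) 0%N; first by rewrite !mul0r.
  by rewrite mu_ad //; apply: ad_self h.
move/eqP; rewrite mu_i0 mul0r eq_sym mulf_eq0.
by rewrite !(negPf (lt0r_neq0 (d_gt0 _))).
Qed.

(** The two sides of the theorem, evaluated at the character [mu j]. *)
Lemma square_prod_normalized j :
  (\prod_i (mu j i / d i)) ^+ 2
    = (\sum_(i | ad i) d i ^+ 2)^-1 * \sum_(i | ad i) d i * mu j i.
Proof.
rewrite -/(regular j).
have [invj|ninvj] := pselect (invertible j).
  rewrite (prod_grading invj) /regular.
  under [X in _ * X]eq_bigr => i adi do rewrite (mu_ad_invertible invj adi) -expr2.
  rewrite mulVf // lt0r_neq0 // (bigD1 ord0) //= ltr_pwDl ?exprn_gt0 //.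
  by apply: sumr_ge0 => i _; rewrite exprn_ge0 // ltW.
rewrite regular_noninvertible // mulr0.
have [i mu_i0] := vanishes_noninvertible ninvj.
by rewrite (bigD1 i) //= mu_i0 !mul0r expr0n.
Qed.

End Burnside.

End FusionRing.

(** * The Grothendieck ring of a modular category *)

Section ModularData.
Variables (K : numClosedFieldType) (C : modularFusionCat K) (n : nat).
Variable X : 'I_n.+1 -> C.
Hypotheses (reps : simple_reps X) (X_unit : X ord0 = unitob C).
Local Notation I := 'I_n.+1.
Implicit Types (i j k l : I) (Y Z : C).

Definition fusion_coef i j k : nat := multiplicity X k (X i \ox X j).

Lemma multiplicity_simple k l : multiplicity X k (X l) = (k == l) :> nat.
Proof. exact: dim_hom_simple. Qed.

Lemma fusion_coef0 j k : fusion_coef ord0 j k = (j == k) :> nat.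
Proof.
rewrite /fusion_coef X_unit.
rewrite (multiplicity_isomorphic X _ (isomorphic_sym (isomorphic_lunit (X j)))).
by rewrite multiplicity_simple eq_sym.
Qed.

Lemma multiplicity_braid k Y Z : multiplicity X k (Y \ox Z) = multiplicity X k (Z \ox Y).
Proof.
by apply: multiplicity_isomorphic; exists (braid Z Y); apply: braid_iso.
Qed.

Lemma fusion_coefC i j k : fusion_coef i j k = fusion_coef j i k.
Proof. exact: multiplicity_braid. Qed.

Lemma multiplicity_dual0 i l : multiplicity X l (dual (X i)) = fusion_coef i l ord0.
Proof.
rewrite /fusion_coef -(multiplicity_dual reps) X_unit.
exact: (multiplicity_isomorphic X _ (isomorphic_runit _)).
Qed.

Lemma sum_delta_mx (F : I -> nat) k : (\sum_i (i == k) * F i = F k)%N.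
Proof.
by rewrite (bigD1 k) //= eqxx mul1n big1 ?addn0 // => i /negPf ->.
Qed.

Lemma multiplicity_tensX k Y j :
  multiplicity X k (Y \ox X j) = (\sum_i multiplicity X i Y * fusion_coef i j k)%N.
Proof.
rewrite (multiplicity_tens reps); apply: eq_bigr => i _.
under eq_bigr do rewrite multiplicity_simple mulnAC mulnC.
exact: sum_delta_mx.
Qed.

(* The sum of the squares of the multiplicities of the simple objects in [X_i^*] is
   the multiplicity of the unit in [X_i (x) X_i^*], that is [1]. *)
Lemma dual_simple i : exists l, forall k, multiplicity X k (dual (X i)) = (k == l) :> nat.
Proof.
pose mult k := multiplicity X k (dual (X i)).
have sum1 : (\sum_k mult k * mult k = 1)%N.
  transitivity (multiplicity X ord0 (X i \ox dual (X i))).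
    rewrite multiplicity_braid multiplicity_tensX; apply: eq_bigr => k _.
    by rewrite /mult {2}multiplicity_dual0 fusion_coefC.
  rewrite multiplicity_braid (multiplicity_dual reps) X_unit.
  rewrite (multiplicity_isomorphic X _ (isomorphic_sym (isomorphic_runit _))).
  by rewrite multiplicity_simple eqxx.
have [l ml|m0] := pickP (fun l => mult l != 0)%N; last first.
  by move: sum1; rewrite big1 // => k _; have /negbFE/eqP -> := m0 k.
exists l => k; rewrite -/(mult k).
move: sum1; rewrite (bigD1 l) //=.
have : (0 < mult l * mult l)%N by rewrite muln_gt0 !lt0n ml.
case E : (mult l * mult l)%N => [//|[|//]] _ [] /eqP.
rewrite sum_nat_eq0 => /forallP rest0.
have [->|kl] := eqVneq k l; first by case: (mult l) E => [|[|?]].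
by have := rest0 k; rewrite kl muln_eq0 orbb => /eqP.
Qed.

Definition simple_dual i : I := sval (cid (dual_simple i)).

Lemma multiplicity_simple_dual i k :
  multiplicity X k (dual (X i)) = (k == simple_dual i) :> nat.
Proof. exact: svalP (cid (dual_simple i)) k. Qed.

Lemma multiplicity_dual_tensX i j k :
  multiplicity X k (dual (X i) \ox X j) = fusion_coef (simple_dual i) j k.
Proof.
rewrite multiplicity_tensX.
under eq_bigr do rewrite multiplicity_simple_dual.
exact: sum_delta_mx.
Qed.

Lemma fusion_coef_dual i j k : fusion_coef (simple_dual i) k j = fusion_coef i j k.
Proof. by rewrite -multiplicity_dual_tensX (multiplicity_dual reps). Qed.

Lemma multiplicity_tens_dual i k :
  multiplicity X k (X i \ox dual (X i)) = fusion_coef i (simple_dual i) k.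
Proof. by rewrite multiplicity_braid multiplicity_dual_tensX fusion_coefC. Qed.

Lemma grouplikeP j :
  grouplike X j <-> invertible fusion_coef simple_dual j.
Proof.
rewrite /grouplike -(gr_class_tens reps) /gr_one; split=> [e k|inv].
  have /rowP/(_ k) := e; rewrite !mxE multiplicity_tens_dual -X_unit.
  by rewrite multiplicity_simple => /eqP; rewrite eqr_nat => /eqP.
apply/rowP => k; rewrite !mxE multiplicity_tens_dual inv -X_unit.
by rewrite multiplicity_simple.
Qed.

Lemma scalar_end_unit : scalar_end (unitob C).
Proof. exact (simple_scalar (fusion_abelian C) (fusion_unit C)). Qed.

Lemma idm_unit_neq0 : idm (unitob C) <> 0.
Proof. by case: (fusion_unit C). Qed.

Lemma scalar_end_reps j : scalar_end (X j).
Proof. by have [simX _ _] := reps; exact (simple_scalar (fusion_abelian C) (simX j)). Qed.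

Lemma monodromy_trace_additive Y : additive_on_sums (monodromy_trace Y).
Proof.
by move=> k F S; apply: (monodromy_trace_direct_sum scalar_end_unit idm_unit_neq0).
Qed.

Lemma monodromy_trace_neq0 j : exists i, monodromy_trace (X j) (X i) != 0.
Proof.
have S_unit := S_nondegenerate reps.
apply: contrapT => row0; have : row j (S_matrix X) = 0.
  apply/rowP => i; rewrite !mxE; apply/eqP; apply: contrapT => /negP h.
  by apply: row0; exists i.
rewrite rowE => /(congr1 (mulmx^~ (invmx (S_matrix X)))).
rewrite mulmxK // mul0mx => /rowP/(_ j); rewrite !mxE !eqxx => /eqP.
by rewrite oner_eq0.
Qed.

(** Otherwise row [j] of the invertible S-matrix would vanish. *)
Lemma qdim_neq0 j : qdim (X j) != 0.
Proof.
have [k] := monodromy_trace_neq0 j; apply: contraNneq => q0; apply/eqP.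
exact: (monodromy_trace_qdim0 scalar_end_unit idm_unit_neq0 _ (@scalar_end_reps j) q0).
Qed.

(** Multiplicativity is applied to the product of the unit with some [X i] whose trace in row [j] is
    nonzero, and that trace is cancelled. *)
Lemma monodromy_trace_unit j : monodromy_trace (X j) (unitob C) = qdim (X j).
Proof.
have tensE Y : monodromy_trace (X j) (unitob C \ox Y) = monodromy_trace (X j) Y.
  exact: additive_isomorphic (@monodromy_trace_additive _)
    (isomorphic_sym (isomorphic_lunit Y)).
have M Y : monodromy_trace (X j) Y * qdim (X j)
    = monodromy_trace (X j) (unitob C) * monodromy_trace (X j) Y.
  rewrite -{1}tensE (monodromy_trace_tens scalar_end_unit idm_unit_neq0) //.
  exact: scalar_end_reps.
have [i mi] := monodromy_trace_neq0 j; apply: (mulIf mi); rewrite -M mulrC.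
by [].
Qed.

Definition s_char j i : K := monodromy_trace (X j) (X i) / qdim (X j).

Lemma s_charP j : character fusion_coef (s_char j).
Proof.
split=> [|i k]; first by rewrite /s_char X_unit monodromy_trace_unit divff ?qdim_neq0.
have q0 := qdim_neq0 j.
apply: (mulIf q0); rewrite /s_char mulrA divfK // mulrAC.
apply: (mulIf q0); rewrite divfK //.
rewrite -(monodromy_trace_tens scalar_end_unit idm_unit_neq0); last first.
  exact: scalar_end_reps.
rewrite (additive_simples reps _ (@monodromy_trace_additive (X j))); congr (_ * _).
rewrite mulr_suml; apply: eq_bigr => l _.
by rewrite -mulrA divfK // mulr_natl.
Qed.

Lemma s_char_unit : \matrix_(j, i) s_char j i \in unitmx.
Proof.
have -> : \matrix_(j, i) s_char j i
    = diag_mx (\row_j (qdim (X j))^-1) *m S_matrix X.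
  by apply/matrixP => j i; rewrite mul_diag_mx !mxE mulrC.
rewrite unitmx_mul S_nondegenerate // andbT unitmxE det_diag unitfE.
by apply/prodf_neq0 => j _; rewrite mxE invr_eq0 qdim_neq0.
Qed.

Lemma qdim_s_char i j : qdim (X i) * s_char i j = qdim (X j) * s_char j i.
Proof.
rewrite /s_char !mulrA ![qdim _ * monodromy_trace _ _]mulrC !mulfK ?qdim_neq0 //.
exact: (monodromy_traceC scalar_end_unit idm_unit_neq0).
Qed.

Section Functionals.
Variables (A : comPzRingType) (f : {rmorphism A -> K}) (a : I -> K).
Hypothesis a_char : character fusion_coef a.

(** The coefficient morphism [f] serves two uses: the integers mapped to [K] for the Burnside
    property, and the identity of the complex numbers for the formula itself. *)
Definition gr_functional (u : 'rV[A]_n.+1) : K := \sum_i f (u 0 i) * a i.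

Lemma gr_functionalD u v : gr_functional (u + v) = gr_functional u + gr_functional v.
Proof. by rewrite -big_split; apply: eq_bigr => i _; rewrite mxE rmorphD mulrDl. Qed.

Lemma gr_functional_simple i : gr_functional (gr_class X A (X i)) = a i.
Proof.
rewrite /gr_functional (bigD1 i) //= mxE multiplicity_simple eqxx rmorph1 mul1r.
rewrite big1 ?addr0 // => j /negPf ji.
by rewrite mxE multiplicity_simple ji rmorph0 mul0r.
Qed.

Lemma gr_functional1 : gr_functional (gr_one X A) = 1.
Proof. by rewrite /gr_one -X_unit gr_functional_simple; case: a_char. Qed.

Lemma gr_functionalM u v :
  gr_functional (gr_mul X u v) = gr_functional u * gr_functional v.
Proof.
have [_ aM] := a_char; rewrite /gr_functional mulr_suml.
transitivity (\sum_l \sum_i \sum_j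
    f (u 0 i) * f (v 0 j) * ((fusion_coef i j l)%:R * a l)).
  apply: eq_bigr => l _; rewrite /gr_mul summxE rmorph_sum mulr_suml.
  apply: eq_bigr => i _; rewrite summxE rmorph_sum mulr_suml.
  by apply: eq_bigr => j _; rewrite !mxE !rmorphM rmorph_nat mulrA.
rewrite exchange_big; apply: eq_bigr => i _ /=.
rewrite exchange_big mulr_sumr; apply: eq_bigr => j _ /=.
by rewrite -mulr_sumr -aM mulrACA.
Qed.

End Functionals.

End ModularData.

(** * The adjoint subcategory described by indices of simple objects *)

Section AdjointSubcategory.
Variables (K : numClosedFieldType) (C : modularFusionCat K) (n : nat).
Variable X : 'I_n.+1 -> C.
Hypotheses (reps : simple_reps X) (X_unit : X ord0 = unitob C).
Local Notation I := 'I_n.+1.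
Local Notation N := (fusion_coef X).
Local Notation star := (simple_dual reps X_unit).
Implicit Types (i j k l : I) (Y Z : C).

Lemma adjoint_unit : adjoint_subcat (X ord0).
Proof. by move=> D [D1 _ _ _] _; rewrite X_unit. Qed.

Lemma adjoint_tens i k l :
  adjoint_subcat (X i) -> adjoint_subcat (X k) -> (N i k l != 0)%N ->
  adjoint_subcat (X l).
Proof.
move=> adi adk Nl D Dsub Dself; have [_ Dtens _ _] := Dsub.
by apply: (subcat_support reps Dsub) Nl; apply: Dtens; [apply: adi|apply: adk].
Qed.

Lemma adjoint_dual i : adjoint_subcat (X i) -> adjoint_subcat (X (star i)).
Proof.
move=> adi D Dsub Dself; have [_ _ Ddual _] := Dsub.
apply: (subcat_support reps Dsub (Ddual _ (adi _ Dsub Dself))).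
by rewrite (multiplicity_simple_dual reps X_unit) eqxx.
Qed.

Lemma adjoint_self i k : (N i (star i) k != 0)%N -> adjoint_subcat (X k).
Proof.
move=> Nk D Dsub Dself; have [simX _ _] := reps.
apply: (subcat_support reps Dsub (Dself _ (simX i))).
by rewrite (multiplicity_tens_dual reps X_unit).
Qed.

Let simple_dualK : involutive star.
Proof.
exact: starK (fusion_coef0 reps X_unit) (fusion_coefC X) (fusion_coef_dual reps X_unit).
Qed.

(** Both sides equal the multiplicity of the unit in [Y \ox X l]. *)
Lemma multiplicity_dual_obj l Y : multiplicity X l (dual Y) = multiplicity X (star l) Y.
Proof.
transitivity (multiplicity X ord0 (Y \ox X l)).
  rewrite -(multiplicity_dual reps) X_unit.
  exact: (multiplicity_isomorphic X _ (isomorphic_runit _)).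
rewrite (multiplicity_tensX reps).
under eq_bigr => i _ do rewrite fusion_coefC
  (fusion_to_unit (fusion_coef0 reps X_unit) (fusion_coefC X)
    (fusion_coef_dual reps X_unit)) mulnC eq_sym.
exact: sum_delta_mx.
Qed.

Lemma tens_support k Y Z : (multiplicity X k (Y \ox Z) != 0)%N -> exists i j,
  [/\ multiplicity X i Y != 0, multiplicity X j Z != 0 & N i j k != 0]%N.
Proof.
move=> h; apply: contrapT => h'; case/eqP: h.
rewrite (multiplicity_tens reps) big1 // => i _; rewrite big1 // => j _.
apply/eqP; apply: contrapT => /negP; rewrite !muln_eq0 !negb_or -andbA => /and3P[? ? ?].
by apply: h'; exists i, j.
Qed.

Lemma simple_support Y k l : simple Y -> (multiplicity X k Y != 0)%N ->
  (multiplicity X l Y != 0)%N -> k = l.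
Proof.
move=> simY; have [_ _ /(_ Y simY)[p isoY]] := reps.
rewrite !(multiplicity_isomorphic X _ (isomorphic_sym isoY)) !multiplicity_simple //.
by case: (k =P p) => [->|//] _; case: (l =P p).
Qed.

Lemma adjoint_min (Q : pred I) : Q ord0 ->
  (forall i k l, Q i -> Q k -> (N i k l != 0)%N -> Q l) ->
  (forall i, Q i -> Q (star i)) ->
  (forall i k, (N i (star i) k != 0)%N -> Q k) ->
  forall i, adjoint_subcat (X i) -> Q i.
Proof.
move=> Q0 QM Qstar Qself i adi.
(* The witness for minimality: the objects all of whose simple constituents have their index in
   [Q]. *)
pose D Y := forall k, (multiplicity X k Y != 0)%N -> Q k.
have mult1 k : multiplicity X k (X k) != 0%N by rewrite (multiplicity_simple reps) eqxx.
apply: (adi D) (mult1 i).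
  split.
  - by move=> k; rewrite -X_unit (multiplicity_simple reps); case: (k =P ord0) => [->|].
  - move=> Y Z DY DZ k /tens_support[p [q [Yp Zq Nk]]].
    exact: QM (DY _ Yp) (DZ _ Zq) Nk.
  - move=> Y DY k; rewrite multiplicity_dual_obj => /DY /Qstar.
    by rewrite simple_dualK.
  - move=> p F S sumS; split=> [DS q k Fk|DF k].
      by apply: DS; apply/(support_direct_sum X k sumS); exists q.
    by move/(support_direct_sum X k sumS) => [q]; apply: DF.
move=> Y simY k /tens_support[p [q [Yp]]].
rewrite multiplicity_dual_obj => Yq Nk; apply: (Qself p).
rewrite -(simple_support simY Yq Yp) in Nk *.
by rewrite simple_dualK.
Qed.

End AdjointSubcategory.

Section BurnsideCharacters.
Variables (K : numClosedFieldType) (C : modularFusionCat K) (n : nat).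
Variable X : 'I_n.+1 -> C.
Hypotheses (reps : simple_reps X) (X_unit : X ord0 = unitob C).
Implicit Types i k l : 'I_n.+1.

Lemma gr_morphism_character (mu : 'rV[int]_n.+1 -> K) : gr_morphism X mu ->
  character (fusion_coef X) (fun i => mu (gr_class X int (X i))).
Proof.
move=> [muD muM mu1]; split=> [|i k]; first by rewrite X_unit.
have mu0 : mu 0 = 0 by apply: (addrI (mu 0)); rewrite -muD !addr0.
have muMn u p : mu (u *+ p) = mu u *+ p.
  by elim: p => [|p IHp]; rewrite ?mulr0n // !mulrS muD IHp.
rewrite -muM -(gr_class_tens reps).
have -> : gr_class X int (X i \ox X k)
    = \sum_l gr_class X int (X l) *+ fusion_coef X i k l.
  apply/rowP => p; rewrite summxE mxE (bigD1 p) //= big1 => [|l /negPf lp].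
    by rewrite addr0 mulmxnE mxE (multiplicity_simple reps) eqxx.
  by rewrite mulmxnE mxE (multiplicity_simple reps) eq_sym lp mul0rn.
rewrite (big_morph mu muD mu0); apply: eq_bigr => l _.
by rewrite muMn mulr_natl.
Qed.

(** A ring morphism on the integral Grothendieck ring restricts to a character of the fusion
    coefficients on the basis, and each character extends back by [gr_functional]. *)
Lemma burnside_character : burnside X K -> forall j,
  (exists a : _ -> K, character (fusion_coef X) a /\ a j = 0)
    <-> ~ invertible (fusion_coef X) (simple_dual reps X_unit) j.
Proof.
move=> burn j; rewrite -(grouplikeP reps X_unit); apply: iff_trans (burn j).
split=> [[a [a_char aj]]|[mu [mu_mor muj]]]; last first.
  exists (fun i => mu (gr_class X int (X i))); split=> //.
  exact: gr_morphism_character.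
exists (gr_functional (intr : {rmorphism int -> K}) a).
rewrite (gr_functional_simple reps); split=> //; split=> [u v|u v|].
- exact: gr_functionalD.
- exact: gr_functionalM.
- exact: (gr_functional1 reps X_unit).
Qed.

End BurnsideCharacters.

Local Open Scope complex_scope.

(** * The positive character is the Frobenius-Perron dimension *)

Section FrobeniusPerronDimension.
Variables (R : realType) (C : modularFusionCat R[i]) (n : nat).
Variable X : 'I_n.+1 -> C.
Hypotheses (reps : simple_reps X) (X_unit : X ord0 = unitob C).
Variable j0 : 'I_n.+1.
Hypothesis d_gt0 : forall i, 0 < s_char X j0 i.
Implicit Types i k l : 'I_n.+1.

Let N := fusion_coef X.
Let d i : R := complex.Re (s_char X j0 i).

Let dE i : (d i)%:C = s_char X j0 i.
Proof. by apply: RRe_real; apply: gtr0_real; apply: d_gt0. Qed.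

Lemma left_mul_mx_row (v : 'rV[R]_n.+1) i k :
  (v *m left_mul_mx X R (X i)) 0 k = \sum_l v 0 l * (N i l k)%:R.
Proof. by rewrite mxE; apply: eq_bigr => l _; rewrite mxE. Qed.

Lemma FPdim_s_char i : (FPdim X R (X i))%:C = s_char X j0 i.
Proof.
rewrite -dE; congr _%:C; rewrite /FPdim; set E := [set _ | _]%classic.
(* A real eigenvalue is bounded by its modulus as a complex number, to which
   [eigenvalue_le_positive_character] applies. *)
have dlub a : E a -> a <= d i.
  move=> [_ /eigenvalueP[v vA v_neq0]].
  rewrite -lecR dE; apply: le_trans (real_ler_norm _) _.
    by apply/complex_realP; exists a.
  apply: (eigenvalue_le_positive_character (s_charP reps X_unit) d_gt0
    (v := fun l => (v 0 l)%:C)).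
    move=> k; have /rowP/(_ k) := vA; rewrite left_mul_mx_row mxE.
    move/(congr1 (real_complex R)).
    rewrite rmorph_sum rmorphM /= => <-; apply: eq_bigr => l _.
    by rewrite rmorphM /= rmorph_nat.
  apply: contrapT => v0; case/eqP: v_neq0; apply/rowP => l; rewrite mxE.
  apply: contrapT => vl; apply: v0; exists l; apply/eqP => h; apply: vl.
  exact: complexI h.
(* The supremum is attained at the positive row vector [d]. The action on rows sums over the middle
   index of [N], so the eigenvector equation is [sum_positive_character], which uses reciprocity. *)
have Ed : E (d i).
  split; first by rewrite -lecR dE ltW.
  apply/eigenvalueP; exists (\row_l d l).
    apply/rowP => k; rewrite left_mul_mx_row mxE mxE; apply: complexI.
    rewrite rmorph_sum rmorphM /= !dE.
    rewrite -(sum_positive_character (fusion_coef_dual reps X_unit)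
      (s_charP reps X_unit) d_gt0).
    by apply: eq_bigr => l _; rewrite mxE rmorphM /= dE rmorph_nat mulrC.
  apply/eqP => /rowP/(_ ord0); rewrite !mxE => /(congr1 (real_complex R)).
  by rewrite dE => /eqP; rewrite (negPf (lt0r_neq0 (d_gt0 _))).
apply/eqP; rewrite eq_le; apply/andP; split.
  by apply: ge_sup => //; exists (d i).
by apply: ub_le_sup => //; exists (d i).
Qed.

End FrobeniusPerronDimension.

Theorem theorem1p16 (R : realType) (C : modularFusionCat R[i])
    (m : nat) (X : 'I_m.+1 -> C)
    (reps : simple_reps X) (X_unit : X ord0 = unitob C)
    (KC_burnside : burnside X R[i]) :
  let x i : 'rV[R[i]]_m.+1 := gr_class X R[i] (X i) in
  let d i : R := FPdim X R (X i) in
  let in_ad i : bool := `[< adjoint_subcat (X i) >] in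
  let FPdim_ad : R := \sum_(i | in_ad i) d i ^+ 2 in
  let P : 'rV[R[i]]_m.+1 := gr_prod X (fun i => (d i)%:C^-1 *: x i) in
  gr_mul X P P = (FPdim_ad)%:C^-1 *: \sum_(i | in_ad i) (d i)%:C *: x i.
Proof.
move=> x d in_ad FPdim_ad P.
have N0 := fusion_coef0 reps X_unit; have NC := fusion_coefC X.
have Nstar := fusion_coef_dual reps X_unit.
have charP := s_charP reps X_unit; have char_unit := s_char_unit reps.
(* The character at [ord0] is proportional to the quantum dimensions, hence vanishes nowhere, as
   [positive_character] requires. *)
have [j0 d_gt0] := positive_character N0 NC Nstar charP char_unit
  (mu_ord0_neq0 charP (qdim_neq0 reps) (qdim_s_char reps)).
have dE i : (d i)%:C = s_char X j0 i by exact: (FPdim_s_char reps X_unit d_gt0 i).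
pose chi j := gr_functional (idfun : {rmorphism R[i] -> R[i]}) (s_char X j).
have chiM j u v : chi j (gr_mul X u v) = chi j u * chi j v by exact: gr_functionalM.
have chi1 j : chi j (gr_one X R[i]) = 1 by exact: (gr_functional1 reps X_unit).
have chiZ j a u : chi j (a *: u) = a * chi j u.
  rewrite /chi /gr_functional mulr_sumr; apply: eq_bigr => i _; rewrite mxE.
  exact: esym (mulrA _ _ _).
have chi0 j : chi j 0 = 0.
  by rewrite /chi /gr_functional big1 // => i _; rewrite mxE mul0r.
have chix j i : chi j (x i) = s_char X j i by exact: (gr_functional_simple reps).
(* Invertibility of the character matrix makes the functionals [chi j] separate the elements of the
   complexified Grothendieck ring. *)
have chi_inj u v : (forall j, chi j u = chi j v) -> u = v.
  move=> uv; apply: trmx_inj; apply: (can_inj (mulKmx char_unit)).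
  apply/colP => j; have := uv j; rewrite /chi /gr_functional /= !mxE => e.
  under eq_bigr do rewrite !mxE mulrC.
  by rewrite e; apply: eq_bigr => i _; rewrite !mxE mulrC.
apply: chi_inj => j; rewrite chiM chiZ.
have -> : chi j P = \prod_i (s_char X j i / s_char X j0 i).
  (* [chi j] is multiplicative and unital, so the bracketing chosen in [gr_prod] does not affect its
     value. *)
  rewrite /P /gr_prod (big_morph (chi j) (chiM j) (chi1 j)).
  by apply: eq_bigr => i _; rewrite chiZ chix dE mulrC.
have -> : chi j (\sum_(i | in_ad i) (d i)%:C *: x i)
    = \sum_(i | in_ad i) s_char X j0 i * s_char X j i.
  rewrite (big_morph (chi j) (gr_functionalD _ _) (chi0 j)).
  by apply: eq_bigr => i _; rewrite chiZ chix dE.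
rewrite -expr2.
rewrite (square_prod_normalized N0 NC Nstar charP char_unit (qdim_neq0 reps)
  (qdim_s_char reps) (burnside_character reps X_unit KC_burnside) d_gt0 (ad := in_ad)).
- congr (_^-1 * _); rewrite /FPdim_ad rmorph_sum; apply: eq_bigr => i _.
  by rewrite rmorphXn /= dE.
- by apply/asboolP; apply: adjoint_unit.
- move=> i k l /asboolP adi /asboolP adk Nl; apply/asboolP.
  exact: (adjoint_tens reps adi adk Nl).
- by move=> i /asboolP adi; apply/asboolP; apply: adjoint_dual.
- by move=> i k Nk; apply/asboolP; apply: (adjoint_self Nk).
- move=> Q Q0 QM Qstar Qself i /asboolP.
  exact: (adjoint_min Q0 QM Qstar Qself).
Qed.
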